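(* Let $d\in\{2,3\}$ and let $\Phi\colon\mathbb{R}^d\to\mathbb{R}_\infty$ be $\Pi_d$-invariant. Define the mapping $$h\colon\mathbb{R}^{k_d}\to\mathbb{R}_\infty,\quad x\mapsto\begin{cases}\Phi(\hat\nu)&\text{if } x=m(\hat\nu)\text{ for some }\hat\nu\in\mathbb{R}^d,\\ \infty&\text{else,}\end{cases}$$ and denote by $h^{\text{lsc-c}}$ its lower semicontinuous convex envelope. Then $$\Phi^{\text{lsc-svpc}}=h^{\text{lsc-c}}\circ m,$$ where $\Phi^{\text{lsc-svpc}}$ is the lower semicontinuous singular value polyconvex envelope of $\Phi$.
   Context: Let $d\in\{2,3\}$, $k_d:=2^d-1$ and $\mathbb{R}_\infty:=\mathbb{R}\cup\{\infty\}$ (where $\infty=+\infty$). Lifting: the map $m\colon\mathbb{R}^d\to\mathbb{R}^{k_d}$ is $m(\hat\nu)=(\hat\nu_1,\hat\nu_2,\hat\nu_1\hat\nu_2)$ if $d=2$, and $m(\hat\nu)=(\hat\nu_1,\hat\nu_2,\hat\nu_3,\hat\nu_2\hat\nu_3,\hat\nu_3\hat\nu_1,\hat\nu_1\hat\nu_2,\hat\nu_1\hat\nu_2\hat\nu_3)$ if $d=3$. Minors of a matrix: for $F\in\mathbb{R}^{d\times d}$ set $\mathcal{M}(F):=(F,\det F)$ if $d=2$ and $\mathcal{M}(F):=(F,\operatorname{adj}F,\det F)$ if $d=3$, where $\operatorname{adj}F$ is the adjoint (adjugate) matrix; $\mathcal{M}(F)$ is regarded as a vector in $\mathbb{R}^{K_d}$,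 with $K_d=\sum_{l=1}^d\binom{d}{l}^2$, i.e. $K_2=5$, $K_3=19$. A function $V\colon\mathbb{R}^{d\times d}\to\mathbb{R}_\infty$ is lower semicontinuous polyconvex (lsc-pc) if there exists a convex and lower semicontinuous function $G\colon\mathbb{R}^{K_d}\to\mathbb{R}_\infty$ with $V(F)=G(\mathcal{M}(F))$ for all $F$. Signed singular values: given $F\in\mathbb{R}^{d\times d}$ with singular values $\sigma_1(F),\dots,\sigma_d(F)\ge 0$, its signed singular values are $\nu(F)=(\nu_1(F),\dots,\nu_d(F))\in\mathbb{R}^d$ with $\nu_i(F)=\varepsilon_i\sigma_i(F)$, $|\nu_i(F)|=\sigma_i(F)$, $\varepsilon_i\in\{1,0,-1\}$, and $\operatorname{sign}(\nu_1\cdots\nu_d)=\varepsilon_1\cdots\varepsilon_d=\operatorname{sign}(\det F)$. They are unique only up to the action of $$\Pi_d=\{P\operatorname{diag}(\varepsilon)\in\mathcal{O}(d)\mid P\in\operatorname{Perm}(d),\ \varepsilon\in\{-1,1\}^d,\ \varepsilon_1\cdots\varepsilon_d=1\},$$ where $\operatorname{Perm}(d)$ is the set of $d\times d$ permutation matrices and $\operatorname{diag}(\cdot)$ is the diagonal matrix with the given diagonal; $\nu(F)$ denotes any such choice. A function $\Phi\colon\mathbb{R}^d\to\mathbb{R}_\infty$ is $\Pi_d$-invariant if $\Phi(\hat\nu)=\Phi(S\hat\nu)$ for all $\hat\nu\in\mathbb{R}^d$, $S\in\Pi_d$. A $\Pi_d$-invariant function $\Psi\colon\mathbb{R}^d\to\mathbb{R}_\infty$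 is lower semicontinuous singular value polyconvex (lsc-svpc) if the function $F\mapsto\Psi(\nu(F))$ on $\mathbb{R}^{d\times d}$ is lsc-pc. The lower semicontinuous singular value polyconvex envelope of $\Phi$ is $\Phi^{\text{lsc-svpc}}(\hat\nu):=\sup\{\Psi(\hat\nu)\mid\Psi\text{ lsc-svpc},\ \Psi\le\Phi\}$ for $\hat\nu\in\mathbb{R}^d$. The lower semicontinuous convex envelope of $h\colon\mathbb{R}^{k_d}\to\mathbb{R}_\infty$ is the largest lower semicontinuous convex function below $h$, i.e. $h^{\text{lsc-c}}(x)=\sup\{g(x)\mid g\colon\mathbb{R}^{k_d}\to\mathbb{R}_\infty\text{ convex and lower semicontinuous},\ g\le h\}$. Suprema are taken pointwise in $[-\infty,\infty]$, with $\sup\emptyset=-\infty$. *)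

(* Defs.v *)
From HB Require Import structures.
From mathcomp Require Import all_boot all_order all_algebra perm.
From mathcomp Require Import all_classical all_reals all_analysis.

Set Implicit Arguments.
Unset Strict Implicit.
Unset Printing Implicit Defensive.

Import Order.TTheory GRing.Theory Num.Theory.
Import numFieldNormedType.Exports.

Local Open Scope classical_set_scope.
Local Open Scope ring_scope.

(* Functions with values in R u {+oo} are functions to \bar R avoiding -oo.   *)
Definition Rinfty_valued (R : realType) (T : Type) (f : T -> \bar R) : Prop :=
  forall x, f x != -oo%E.

(* The library convention 0 * +oo = 0 makes t = 0 and t = 1 harmless.         *)
Definition convex_efun (R : realType) (E : lmodType R) (g : E -> \bar R) :
    Prop :=
  forall (x y : E) (t : R), 0 <= t <= 1 ->
    (g (t *: x + (1 - t) *: y)%R <= t%:E * g x + (1 - t)%:E * g y)%E.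

Definition lsc_convex (R : realType) (n : nat) (g : 'rV[R]_n -> \bar R) :
    Prop :=
  [/\ Rinfty_valued g, convex_efun g & lower_semicontinuous g].

Definition lsc_convex_envelope (R : realType) (n : nat)
    (h : 'rV[R]_n -> \bar R) (x : 'rV[R]_n) : \bar R :=
  ereal_sup [set g x | g in
    [set g | lsc_convex g /\ forall y, (g y <= h y)%E]].

(* Only d = 2 and d = 3 are meaningful in mlift and minors; the value for the *)
(* other d is a dummy.                                                        *)
Definition mlift (R : realType) (d : nat) : 'rV[R]_d -> 'rV[R]_(2 ^ d - 1) :=
  match d with
  | 2 => fun v =>
      let v1 := v 0 (@Ordinal 2 0 isT) in
      let v2 := v 0 (@Ordinal 2 1 isT) in
      \row_(j < 3) [:: v1; v2; v1 * v2]`_j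
  | 3 => fun v =>
      let v1 := v 0 (@Ordinal 3 0 isT) in
      let v2 := v 0 (@Ordinal 3 1 isT) in
      let v3 := v 0 (@Ordinal 3 2 isT) in
      \row_(j < 7) [:: v1; v2; v3; v2 * v3; v3 * v1; v1 * v2; v1 * v2 * v3]`_j
  | _ => fun=> 0
  end.

Lemma mlift_inj (R : realType) (d : nat) :
  d = 2%N \/ d = 3%N -> injective (@mlift R d).
Proof.
case=> -> u v /rowP uv; apply/rowP => -[k kd].
- case: k kd => [|[|//]] kd.
  + by have := uv (@Ordinal 3 0 isT); rewrite !mxE /= !(bool_irrelevance kd isT).
  + by have := uv (@Ordinal 3 1 isT); rewrite !mxE /= !(bool_irrelevance kd isT).
- case: k kd => [|[|[|//]]] kd.
  + by have := uv (@Ordinal 7 0 isT); rewrite !mxE /= !(bool_irrelevance kd isT).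
  + by have := uv (@Ordinal 7 1 isT); rewrite !mxE /= !(bool_irrelevance kd isT).
  + by have := uv (@Ordinal 7 2 isT); rewrite !mxE /= !(bool_irrelevance kd isT).
Qed.

(* By injectivity of mlift the preimage picked by xget is the only one.       *)
Definition lifted_fun (R : realType) (d : nat) (Phi : 'rV[R]_d -> \bar R)
    (x : 'rV[R]_(2 ^ d - 1)) : \bar R :=
  if x \in range (@mlift R d)
  then Phi (xget 0 [set v | x = mlift v])
  else +oo%E.

Lemma lifted_fun_mlift (R : realType) (d : nat) (Phi : 'rV[R]_d -> \bar R)
    (v : 'rV[R]_d) :
  d = 2%N \/ d = 3%N -> lifted_fun Phi (mlift v) = Phi v.
Proof.
move=> hd; rewrite /lifted_fun mem_set; last by exists v.
case: xgetP => [w _ /= /(mlift_inj hd) -> //|/(_ v)].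
by case.
Qed.

Lemma lifted_fun_out (R : realType) (d : nat) (Phi : 'rV[R]_d -> \bar R)
    (x : 'rV[R]_(2 ^ d - 1)) :
  (forall v, x <> mlift v) -> lifted_fun Phi x = +oo%E.
Proof.
by move=> xN; rewrite /lifted_fun memNset// => -[v _ vx]; exact: (xN v).
Qed.

Definition minors_dim (d : nat) : nat :=
  match d with
  | 2 => 2 * 2 + 1
  | 3 => (3 * 3 + 3 * 3) + 1
  | _ => 0
  end.

Lemma minors_dimE (d : nat) : d = 2%N \/ d = 3%N ->
  minors_dim d = (\sum_(1 <= l < d.+1) 'C(d, l) ^ 2)%N.
Proof. by case=> ->; rewrite unlock. Qed.

Definition minors (R : realType) (d : nat) : 'M[R]_d -> 'rV[R]_(minors_dim d) :=
  match d with
  | 2 => fun F : 'M[R]_2 => row_mx (mxvec F) (\det F)%:M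
  | 3 => fun F : 'M[R]_3 => row_mx (row_mx (mxvec F) (mxvec (\adj F))) (\det F)%:M
  | _ => fun=> 0
  end.

Definition lsc_pc (R : realType) (d : nat) (V : 'M[R]_d -> \bar R) : Prop :=
  exists G : 'rV[R]_(minors_dim d) -> \bar R,
    lsc_convex G /\ forall F, V F = G (minors F).

(* The sigma_i are the nonnegative square roots of the eigenvalues of F^T F,  *)
(* listed with multiplicity in an arbitrary order.                            *)
Definition singular_values (R : realType) (d : nat) (F : 'M[R]_d)
    (sigma : 'rV[R]_d) : Prop :=
  (forall i, 0 <= sigma 0 i) /\
  char_poly (F^T *m F) = \prod_(i < d) ('X - (sigma 0 i ^+ 2)%:P).

Definition signed_singular_values (R : realType) (d : nat) (F : 'M[R]_d)
    (nu : 'rV[R]_d) : Prop :=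
  exists sigma eps : 'rV[R]_d,
    [/\ singular_values F sigma,
        forall i, eps 0 i \in [:: 1; 0; -1],
        forall i, nu 0 i = eps 0 i * sigma 0 i /\ `|nu 0 i| = sigma 0 i,
        Num.sg (\prod_(i < d) nu 0 i) = \prod_(i < d) eps 0 i &
        \prod_(i < d) eps 0 i = Num.sg (\det F)].

(* One choice of signed singular values. They are unique up to the signed     *)
(* permutations in Pi_group below, so that composition of a Pi_invariant      *)
(* function with ssv does not depend on this choice.                          *)
Definition ssv (R : realType) (d : nat) (F : 'M[R]_d) : 'rV[R]_d :=
  xget 0 [set nu | signed_singular_values F nu].

Definition Pi_group (R : realType) (d : nat) : set 'M[R]_d :=
  [set S | exists (s : 'S_d) (eps : 'rV[R]_d),
    [/\ S = perm_mx s *m diag_mx eps,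
        forall i, eps 0 i = 1 \/ eps 0 i = -1 &
        \prod_(i < d) eps 0 i = 1]].

(* Points of R^d are row vectors, so S applied to v is v *m S^T.              *)
Definition Pi_invariant (R : realType) (d : nat) (Phi : 'rV[R]_d -> \bar R) :
    Prop :=
  forall (v : 'rV[R]_d) (S : 'M[R]_d), Pi_group S -> Phi v = Phi (v *m S^T).

Definition lsc_svpc (R : realType) (d : nat) (Psi : 'rV[R]_d -> \bar R) :
    Prop :=
  [/\ Rinfty_valued Psi, Pi_invariant Psi & lsc_pc (Psi \o @ssv R d)].

Definition lsc_svpc_envelope (R : realType) (d : nat)
    (Phi : 'rV[R]_d -> \bar R) (v : 'rV[R]_d) : \bar R :=
  ereal_sup [set Psi v | Psi in
    [set Psi | lsc_svpc Psi /\ forall w, (Psi w <= Phi w)%E]].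

(* Main.v *)
Require Import Defs.
From HB Require Import structures.
From mathcomp Require Import all_boot all_order all_algebra perm.
From mathcomp Require Import complex ring lra zify.
From mathcomp Require Import all_classical all_reals all_analysis.

(* Let K be the set of pairs (Q1, Q2) of orthogonal matrices with            *)
(* det Q1 * det Q2 = 1. Up to Pi_d, the signed singular values of F are the  *)
(* nu with F = Q1 diag(nu) Q2 for some pair in K.                            *)
(* If Psi o ssv = G o minors, then restricting G to diagonal matrices, on    *)
(* which minors depends linearly on m(nu), gives a convex lsc function g     *)
(* with Psi = g o m.                                                         *)
(* Conversely, for convex lsc g below h, let G be the supremum over K of the *)
(* functions X |-> g(diagonal part of Q1 X Q2). Then G o minors is           *)
(* K-invariant, and Psi(nu) := G(minors(diag nu)) is lsc-svpc and at least   *)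
(* g o m. The inequality Psi <= Phi follows from convexity once the matrix   *)
(* A_ij = Q1_ij Q2_ji, by which both nu and its adjugate are multiplied, is  *)
(* known to be in the convex hull of Pi_d. For d = 3, Pi_3 is the symmetry   *)
(* group of a regular tetrahedron, so that its hull is a copy of the         *)
(* polytope of doubly stochastic 4 x 4 matrices; A is in it because every    *)
(* rotation of R^3 has trace at least -1.                                    *)

Set Implicit Arguments.
Unset Strict Implicit.
Unset Printing Implicit Defensive.

Import Order.TTheory GRing.Theory Num.Theory.
Import numFieldNormedType.Exports.

Local Open Scope ring_scope.

(** * Singular value decomposition *)

(** Every competitor for one envelope yields a competitor for the other. If Psi o ssv = G o minors,
    then on diagonal matrices the minors are a linear function of m(nu), so Psi = g o m with g
    convex and lsc; off the range of m the bound g <= h is trivial ([lsc_svpc_envelope_le]).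
    Conversely ([lsc_svpc_envelope_ge]), a convex lsc g <= h is symmetrised by a supremum over K.
    The result G is convex and lsc in the minors, because these transform linearly under F |-> Q1 F
    Q2. By [isopair_svd_exists] and [signed_singular_values_uniq], its invariance makes G o minors a
    function of signed singular values. The delicate point is that symmetrising does not exceed Phi.
    The diagonals of Q1 diag(nu) Q2 and of its adjugate arise from those of diag(nu) and its
    adjugate through the same matrix A. For A in Pi_d one obtains m(A nu), where g is at most Phi(A
    nu) = Phi(nu); with nu fixed, convexity of g extends this bound to the hull of Pi_d. Every A
    lies in that hull: explicitly for d = 2 ([hadamard_isopair2_hull]), and through [birkhoff] and
    [rotation3_trace] for d = 3 ([hadamard_isopair3_hull]). *)

Lemma row_sqr_ge0 (R : realDomainType) n (v : 'rV[R]_n) : 0 <= (v *m v^T) 0 0.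
Proof. by rewrite mxE sumr_ge0// => i _; rewrite mxE -expr2 sqr_ge0. Qed.

Lemma row_sqr_eq0 (R : realDomainType) n (v : 'rV[R]_n) :
  ((v *m v^T) 0 0 == 0) = (v == 0).
Proof.
apply/eqP/eqP => [|->]; last by rewrite mul0mx mxE.
rewrite mxE => /eqP.
rewrite psumr_eq0 => [/allP v0|i _]; last by rewrite mxE -expr2 sqr_ge0.
apply/rowP => i; have /implyP/(_ isT) := v0 i (mem_index_enum i).
by rewrite !mxE -expr2 sqrf_eq0 => /eqP.
Qed.

Lemma row_sqrE (R : realDomainType) n (v : 'rV[R]_n) :
  v *m v^T = ((v *m v^T) 0 0)%:M.
Proof. exact: mx11_scalar. Qed.

Lemma exists_unit_multiple (R : rcfType) n (v : 'rV[R]_n) : v != 0 ->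
  exists2 c : R, c != 0 & (c *: v) *m (c *: v)^T = 1%:M.
Proof.
move=> v0; set q := (v *m v^T) 0 0.
have q0 : 0 < q by rewrite lt_neqAle eq_sym row_sqr_eq0 v0 row_sqr_ge0.
exists (Num.sqrt q)^-1; first by rewrite invr_eq0 sqrtr_eq0 -ltNge.
rewrite linearZ /= -scalemxAl -scalemxAr scalerA row_sqrE -/q scale_scalar_mx.
by rewrite -invfM -expr2 sqr_sqrtr ?ltW// mulVf// gt_eqF.
Qed.

(** Take a complex eigenvector x + iy with eigenvalue a + ib. Symmetry of A gives b (|x|^2 + |y|^2)
    = 0, so b = 0 and whichever of x and y is nonzero is a real eigenvector. *)
Lemma symmetric_eigenvector (R : rcfType) n (A : 'M[R]_n.+1) : A^T = A ->
  exists u : 'rV[R]_n.+1, exists2 a, u != 0 & u *m A = a *: u.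
Proof.
move=> Asym; pose AC := map_mx (real_complex R) A.
have [[a b] /eigenvalueP[v vA v0]] := eigenvalue_closed AC (ltn0Sn n).
pose x := map_mx (@complex.Re R) v; pose y := map_mx (@complex.Im R) v.
have xA : x *m A = a *: x - b *: y.
  apply/rowP => j; have /(congr1 (@complex.Re R)) := congr1 (fun w : 'rV_ _ => w 0 j) vA.
  rewrite !mxE /= => e.
  transitivity (complex.Re (\sum_k v 0 k * AC k j)).
    rewrite raddf_sum/=; apply: eq_bigr => k _; rewrite !mxE; case: (v 0 k) => r s /=.
    by rewrite mulr0 subr0.
  by rewrite e; case: (v 0 j).
have yA : y *m A = b *: x + a *: y.
  apply/rowP => j; have /(congr1 (@complex.Im R)) := congr1 (fun w : 'rV_ _ => w 0 j) vA.
  rewrite !mxE /= => e.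
  transitivity (complex.Im (\sum_k v 0 k * AC k j)).
    rewrite raddf_sum/=; apply: eq_bigr => k _; rewrite !mxE; case: (v 0 k) => r s /=.
    by rewrite mulr0 add0r.
  by rewrite e; case: (v 0 j) => r s /=; rewrite addrC.
have xy0 : (x != 0) || (y != 0).
  rewrite -negb_and; apply: contra v0 => /andP[/eqP x0 /eqP y0].
  apply/eqP/rowP => j; move/rowP/(_ j): x0; move/rowP/(_ j): y0; rewrite !mxE.
  by case: (v 0 j) => r s /= -> ->.
have bxy : b * ((x *m x^T) 0 0 + (y *m y^T) 0 0) = 0.
  have e : (x *m A *m y^T)^T = y *m A *m x^T by rewrite !trmx_mul trmxK Asym mulmxA.
  have : (x *m A *m y^T) 0 0 = (y *m A *m x^T) 0 0 by rewrite -e [RHS]mxE.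
  have yx : (y *m x^T) 0 0 = (x *m y^T) 0 0 by rewrite -[in LHS](trmxK y) -trmx_mul mxE.
  rewrite xA yA mulmxBl mulmxDl -!scalemxAl.
  have cE (c d : R) (M N : 'M[R]_1) :
      (c *: M + d *: N) 0 0 = c * M 0 0 + d * N 0 0 by rewrite !mxE.
  rewrite -scaleNr !cE yx => h; move: h; move: (_ 0 0) (_ 0 0) (_ 0 0) => p q r; lra.
have b0 : b = 0.
  apply/eqP; move/eqP: bxy; rewrite mulf_eq0 => /orP[//|].
  rewrite paddr_eq0 ?row_sqr_ge0// !row_sqr_eq0.
  by case/andP => x0 y0; move: xy0; rewrite x0 y0.
case/orP: xy0 => [x0|y0].
- by exists x, a; rewrite // xA b0 scale0r subr0.
- by exists y, a; rewrite // yA b0 scale0r add0r.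
Qed.

(** The reflection in the hyperplane orthogonal to v = u - e exchanges the unit vectors e and u,
    since |v|^2 = 2 - 2 u_0 = -2 <e, v>. *)
Lemma householder (R : rcfType) n (u : 'rV[R]_n.+1) : u *m u^T = 1%:M ->
  exists2 H : 'M[R]_n.+1, H *m H^T = 1%:M & delta_mx 0 0 *m H = u.
Proof.
move=> uu; pose e : 'rV[R]_n.+1 := delta_mx 0 0.
have [v vE] : exists v : 'rV[R]_n.+1, v = u - e by exists (u - e).
have [v0|v0] := eqVneq v 0.
  exists 1%:M; first by rewrite mul1mx trmx1.
  by rewrite mulmx1; apply/esym/subr0_eq; rewrite -vE.
pose q : R := (v *m v^T) 0 0.
have q0 : q != 0 by rewrite row_sqr_eq0.
have vv : v *m v^T = q%:M by exact: row_sqrE.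
have ee : e *m e^T = 1%:M.
  by rewrite /e trmx_delta mul_delta_mx; apply/matrixP=> i j; rewrite !ord1 !mxE.
have ue : u *m e^T = (u 0 0)%:M.
  by rewrite /e trmx_delta [LHS]mx11_scalar -colE mxE.
have eu : e *m u^T = (u 0 0)%:M by rewrite -[LHS]trmxK trmx_mul trmxK ue tr_scalar_mx.
have qE : q = 2 - 2 * u 0 0.
  rewrite /q vE linearB/= mulmxBl !mulmxBr uu ee ue eu !mxE/=.
  by ring.
have ev : e *m v^T = (u 0 0 - 1)%:M by rewrite vE linearB/= mulmxBr eu ee -raddfB.
exists (1%:M - (2 / q) *: (v^T *m v)).
  have -> : (1%:M - (2 / q) *: (v^T *m v))^T = 1%:M - (2 / q) *: (v^T *m v).
    by rewrite raddfB/= trmx1 [X in _ - X]linearZ/= trmx_mul trmxK.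
  rewrite mulmxBr mulmx1 mulmxBl mul1mx.
  rewrite -scalemxAl -scalemxAr mulmxA -(mulmxA v^T v) vv mul_mx_scalar.
  rewrite -scalemxAl !scalerA -addrA -opprD -scalerBl -scalerDl.
  by rewrite [X in X *: _](_ : _ = 0) ?scale0r ?subr0//; field.
rewrite mulmxBr mulmx1 -scalemxAr mulmxA ev mul_scalar_mx scalerA.
have -> : 2 / q * (u 0 0 - 1) = -1 by rewrite qE; field; rewrite -qE.
by rewrite scaleN1r opprK vE addrC subrK.
Qed.

Lemma exists_singular_triple (R : rcfType) n (F : 'M[R]_n.+1) :
  exists (u w : 'rV[R]_n.+1) (c : R),
    [/\ u *m u^T = 1%:M, w *m w^T = 1%:M, u *m F^T = c *: w & w *m F = c *: u].
Proof.
have [//|u0 [a u0N0 u0E]] := @symmetric_eigenvector R n (F^T *m F).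
  by rewrite trmx_mul trmxK.
have [k k0 uu] := exists_unit_multiple u0N0.
set u := k *: u0 in uu.
have uE : u *m F^T *m F = a *: u.
  by rewrite /u -mulmxA -scalemxAl u0E !scalerA mulrC.
(* If u F^T = 0 then F is singular, and w is any unit vector in its left kernel, with c = 0.
   Otherwise w is u F^T normalised, and c is the square root of the eigenvalue a of F^T F. *)
have [z0|zN0] := eqVneq (u *m F^T) 0.
  have : \det F = 0.
    rewrite -det_tr; apply/eqP/det0P; exists u => //.
    apply/eqP => u0'; move/matrixP/(_ 0 0)/eqP: uu.
    by rewrite u0' mul0mx !mxE eq_sym oner_eq0.
  move/eqP/det0P => [w wN0 wF].
  have [l l0 ww] := exists_unit_multiple wN0.
  by exists u, (l *: w), 0; split; rewrite // ?scale0r// -scalemxAl wF scaler0.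
have zz : (u *m F^T) *m (u *m F^T)^T = a%:M.
  by rewrite trmx_mul trmxK mulmxA uE -scalemxAl uu scale_scalar_mx mulr1.
have a0 : 0 < a.
  rewrite lt_neqAle; have -> : a = (u *m F^T *m (u *m F^T)^T) 0 0 by rewrite zz mxE eqxx.
  by rewrite eq_sym row_sqr_eq0 zN0 row_sqr_ge0.
have sN0 : Num.sqrt a != 0 by rewrite sqrtr_eq0 -ltNge.
exists u, ((Num.sqrt a)^-1 *: (u *m F^T)), (Num.sqrt a); split => //.
- rewrite [(_ *: _)^T]linearZ /= -scalemxAl -scalemxAr zz scalerA scale_scalar_mx.
  by rewrite -invfM -expr2 sqr_sqrtr ?ltW// mulVf ?gt_eqF.
- by rewrite scalerA divff// scale1r.
- rewrite -scalemxAl uE scalerA; congr (_ *: _).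
  by rewrite -{2}(sqr_sqrtr (ltW a0)) expr2 mulKf.
Qed.

Lemma svd_exists (R : rcfType) n (F : 'M[R]_n) :
  exists (U V : 'M[R]_n) (s : 'rV[R]_n),
    [/\ U *m U^T = 1%:M, V *m V^T = 1%:M & F = U *m diag_mx s *m V].
Proof.
elim: n F => [|n IH] F.
  by exists 0, 0, 0; split; apply/matrixP => -[].
have [u [w [c [uu ww uF wF]]]] := exists_singular_triple F.
have [H HH He] := householder uu; have [K KK Ke] := householder ww.
have HH' := mulmx1C HH; have KK' := mulmx1C KK.
have [F' F'E] : exists F' : 'M[R]_(1 + n), F' = K *m F *m H^T by exists (K *m F *m H^T).
have e0 : delta_mx 0 0 *m F' = c *: delta_mx 0 0 :> 'rV_(1 + n).
  by rewrite F'E !mulmxA Ke wF -scalemxAl -He -mulmxA HH mulmx1.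
have e0' : delta_mx 0 0 *m F'^T = c *: delta_mx 0 0 :> 'rV_(1 + n).
  by rewrite F'E !trmx_mul trmxK !mulmxA He uF -scalemxAl -Ke -mulmxA KK mulmx1.
(* In the bases adapted to u and w, both the first row and the first column of F' are c times a
   basis vector, so the induction applies to the remaining block. *)
have FE : F' = block_mx c%:M 0 0 (drsubmx F').
  rewrite -[LHS]submxK; congr block_mx.
  - apply/matrixP => i j; rewrite !ord1 !mxE eqxx mulr1n.
    move/rowP/(_ 0): e0; rewrite -rowE !mxE/= mulr1 => <-.
    by congr (_ _ _); apply/val_inj.
  - apply/matrixP => i j; rewrite !ord1 !mxE.
    move/rowP/(_ (rshift 1 j)): e0; rewrite -rowE !mxE/= mulr0 => <-.
    by congr (_ _ _); apply/val_inj.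
  - apply/matrixP => j i; rewrite !ord1 !mxE.
    move/rowP/(_ (rshift 1 j)): e0'; rewrite -rowE !mxE/= mulr0 => <-.
    by congr (_ _ _); apply/val_inj.
have [U [V [s [UU VV FE']]]] := IH (drsubmx F').
pose ext (W : 'M[R]_n) : 'M[R]_(1 + n) := block_mx 1%:M 0 0 W.
have extT W : W *m W^T = 1%:M -> ext W *m (ext W)^T = 1%:M.
  move=> WW; rewrite /ext tr_block_mx mulmx_block !trmx0 !mulmx0 !mul0mx !addr0 !add0r.
  by rewrite trmx1 mulmx1 WW -scalar_mx_block.
pose s' : 'rV[R]_(1 + n) := row_mx c%:M s.
have FE1 : F' = ext U *m diag_mx s' *m ext V.
  rewrite FE FE' /ext /s' diag_mx_row !mulmx_block !mulmx0 !mul0mx !addr0 !add0r.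
  rewrite !mul1mx mulmx1 !mul0mx; congr block_mx.
  by apply/matrixP=> i j; rewrite !ord1 !mxE.
exists (K^T *m ext U), (ext V *m H), s'; split.
- by rewrite trmx_mul trmxK -mulmxA (mulmxA (ext U)) extT// mul1mx.
- by rewrite trmx_mul -mulmxA (mulmxA H) HH mul1mx extT.
- rewrite -!mulmxA (mulmxA _ _ H) (mulmxA (ext U)) (mulmxA (ext U)) -FE1.
  by rewrite F'E -!mulmxA HH' mulmx1 mulmxA KK' mul1mx.
Qed.

(** * Signed singular values *)

(** Membership in K: the two determinants may both be -1, and F |-> Q1 F Q2 preserves det F. *)
Definition isopair (R : realFieldType) d (Q1 Q2 : 'M[R]_d) :=
  [/\ Q1 *m Q1^T = 1%:M, Q2 *m Q2^T = 1%:M & \det Q1 * \det Q2 = 1].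

Lemma isopairM (R : realFieldType) d (Q1 Q2 P1 P2 : 'M[R]_d) :
  isopair Q1 Q2 -> isopair P1 P2 -> isopair (Q1 *m P1) (P2 *m Q2).
Proof.
move=> [Q1E Q2E detQ] [P1E P2E detP]; split.
- by rewrite trmx_mul -mulmxA (mulmxA P1) P1E mul1mx.
- by rewrite trmx_mul -mulmxA (mulmxA Q2) Q2E mul1mx.
- by rewrite !det_mulmx mulrACA -[RHS](mulr1 1) -{1}detQ -detP; ring.
Qed.

Lemma isopair_trmx (R : realFieldType) d (Q1 Q2 : 'M[R]_d) :
  isopair Q1 Q2 -> isopair Q1^T Q2^T.
Proof.
by case=> Q1E Q2E detQ; split; rewrite ?trmxK ?det_tr//; exact: mulmx1C.
Qed.

Lemma isopair1 (R : realFieldType) d : isopair (1%:M : 'M[R]_d) 1%:M.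
Proof. by split; rewrite ?trmx1 ?mulmx1 ?det1 ?mulr1. Qed.

Lemma orthogonal_det (R : realFieldType) d (Q : 'M[R]_d) : Q *m Q^T = 1%:M ->
  \det Q = 1 \/ \det Q = -1.
Proof.
move/(congr1 determinant); rewrite det_mulmx det_tr det1 -expr2 => /eqP.
by rewrite sqrf_eq1 => /orP[] /eqP; [left|right].
Qed.

Lemma isopair_det (R : realFieldType) n (Q1 Q2 F : 'M[R]_n) :
  isopair Q1 Q2 -> \det (Q1 *m F *m Q2) = \det F.
Proof. by case=> _ _ detQ; rewrite !det_mulmx mulrAC detQ mul1r. Qed.

Lemma isopair_svd_exists (R : rcfType) n (F : 'M[R]_n) :
  exists (Q1 Q2 : 'M[R]_n) (nu : 'rV[R]_n),
    isopair Q1 Q2 /\ F = Q1 *m diag_mx nu *m Q2.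
Proof.
have [U [V [s [UU VV FE]]]] := svd_exists F.
have [detUV|detUV] : \det U * \det V = 1 \/ \det U * \det V = -1.
  by case: (orthogonal_det UU) => ->; case: (orthogonal_det VV) => ->;
    rewrite ?mulrN1 ?mulr1 ?opprK; auto.
  by exists U, V, s; split.
case: n F U V s UU VV FE detUV => [|n] F U V s UU VV FE detUV.
  by exists U, V, s; split=> //; split; rewrite ?det_mx00 ?mulr1.
(* When det U det V = -1, the first column of U and the first entry of s change sign together, which
   leaves the product unchanged. *)
pose e : 'rV[R]_n.+1 := \row_j (if j == 0 then -1 else 1).
have ee : diag_mx e *m diag_mx e = 1%:M.
  rewrite mulmx_diag -diag_const_mx; congr diag_mx; apply/rowP => j; rewrite !mxE.
  by case: ifP; rewrite ?mulrNN mulr1.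
have dete : \det (diag_mx e) = -1.
  rewrite det_diag big_ord_recl !mxE eqxx big1 ?mulr1// => i _.
  by rewrite !mxE.
exists (U *m diag_mx e), V, (\row_j (e 0 j * s 0 j)); split.
  split => //; last by rewrite det_mulmx dete mulrN1 mulNr detUV opprK.
  by rewrite trmx_mul tr_diag_mx -mulmxA (mulmxA _ _ U^T) ee mul1mx.
by rewrite -mulmx_diag -!mulmxA (mulmxA (diag_mx e)) ee mul1mx !mulmxA.
Qed.

Lemma char_poly_orthogonal_conj (R : realFieldType) n (Q A : 'M[R]_n) :
  Q *m Q^T = 1%:M -> char_poly (Q^T *m A *m Q) = char_poly A.
Proof.
move=> /mulmx1C QQ; rewrite /char_poly.
have -> : char_poly_mx (Q^T *m A *m Q) =
    map_mx polyC Q^T *m char_poly_mx A *m map_mx polyC Q.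
  rewrite /char_poly_mx mulmxBr mulmxBl -!map_mxM; congr (_ - _).
  by rewrite mul_mx_scalar -scalemxAl -map_mxM QQ map_mx1 scalemx1.
rewrite !det_mulmx mulrC mulrA -det_mulmx -map_mxM (mulmx1C QQ).
by rewrite map_mx1 det1 mul1r.
Qed.

Lemma char_poly_diag (R : realFieldType) n (s : 'rV[R]_n) :
  char_poly (diag_mx s) = \prod_(i < n) ('X - (s 0 i)%:P).
Proof.
rewrite char_poly_trig ?diag_mx_is_trig//.
by apply: eq_bigr => i _; rewrite mxE eqxx.
Qed.

Lemma signed_singular_values_svd (R : realType) n (Q1 Q2 : 'M[R]_n) nu :
  isopair Q1 Q2 -> signed_singular_values (Q1 *m diag_mx nu *m Q2) nu.
Proof.
move=> Q12; have detE := isopair_det (diag_mx nu) Q12; have [Q1E Q2E _] := Q12.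
have sgE : \prod_(i < n) Num.sg (nu 0 i) = Num.sg (\prod_(i < n) nu 0 i).
  by apply/esym/big_morph => [x y|]; rewrite ?sgrM ?sgr1.
exists (\row_i `|nu 0 i|), (\row_i Num.sg (nu 0 i)); split.
- split=> [i|]; first by rewrite mxE.
  rewrite !trmx_mul tr_diag_mx -!mulmxA (mulmxA Q1^T) (mulmx1C Q1E) mul1mx.
  rewrite (mulmxA (diag_mx nu)) mulmx_diag mulmxA char_poly_orthogonal_conj//.
  rewrite char_poly_diag; apply: eq_bigr => i _; rewrite !mxE.
  by rewrite real_normK ?num_real// expr2.
- move=> i; rewrite mxE !inE.
  by case: sgrP => _; rewrite eqxx ?orbT.
- by move=> i; rewrite !mxE -numEsg.
- by rewrite -sgE; apply: eq_bigr => i _; rewrite mxE.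
- by rewrite detE det_diag -sgE; apply: eq_bigr => i _; rewrite mxE.
Qed.

Lemma Pi_group_mulE (R : realType) n (s : 'S_n) (eps v : 'rV[R]_n) i :
  (v *m (perm_mx s *m diag_mx eps)^T) 0 i = v 0 (s i) * eps 0 (s i).
Proof.
rewrite trmx_mul tr_diag_mx tr_perm_mx mulmxA -[s in LHS]invgK -col_permE mxE invgK.
by rewrite mul_mx_diag mxE.
Qed.

(** The characteristic polynomial of F^T F determines the squares up to a permutation p, so only
    signs remain to be chosen. Their product must be 1; this follows because both vectors have a
    product with the sign of det F. *)
Lemma signed_singular_values_uniq (R : realType) n (F : 'M[R]_n) mu nu :
  signed_singular_values F mu -> signed_singular_values F nu ->
  exists2 S, Pi_group S & nu = mu *m S^T.
Proof.
move=> [s1 [? [[s1ge0 s1E] _ mE pm1 pm2]]] [s2 [? [[s2ge0 s2E] _ nE pn1 pn2]]].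
have /prod_XsubC_eq : \prod_(x <- [tuple s2 0 i ^+ 2 | i < n]) ('X - x%:P) =
    \prod_(x <- [tuple s1 0 i ^+ 2 | i < n]) ('X - x%:P).
  by rewrite !big_image /= -s1E -s2E.
move/tuple_permP => [p pE].
have absE i : `|nu 0 i| = `|mu 0 (p i)|.
  rewrite (nE i).2 (mE (p i)).2; apply/eqP; rewrite -(@eqrXn2 _ 2)//; apply/eqP.
  by move/val_inj/(congr1 (fun t => tnth t i)): pE; rewrite !tnth_mktuple.
have prodE : \prod_i nu 0 i = \prod_i mu 0 (p i).
  have <- : \prod_i mu 0 i = \prod_i mu 0 (p i) by rewrite (reindex_inj (@perm_inj _ p)).
  rewrite [LHS]numEsg [RHS]numEsg pm1 pn1 pm2 pn2 !normr_prod; congr (_ * _).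
  rewrite [RHS](reindex_inj (@perm_inj _ p)).
  by apply: eq_bigr => i _; exact: absE.
have sgE i : exists2 e : R, e = 1 \/ e = -1 & nu 0 i = mu 0 (p i) * e.
  case/eqP: (absE i); rewrite eqr_norm2 => /orP[]/eqP ->.
    by exists 1; [left|rewrite mulr1].
  by exists (-1); [right|rewrite mulrN1].
pose e i := s2val (cid2 (sgE i)).
have e1 i : e i = 1 \/ e i = -1 by rewrite /e; case: cid2.
have eE i : nu 0 i = mu 0 (p i) * e i by rewrite /e; case: cid2.
have eN0 i : e i != 0 by case: (e1 i) => ->; rewrite ?oppr_eq0 oner_eq0.
suff [f [f1 fE prodf]] : exists f : 'I_n -> R,
    [/\ forall i, f i = 1 \/ f i = -1, forall i, nu 0 i = mu 0 (p i) * f i &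
        \prod_i f i = 1].
  exists (perm_mx p *m diag_mx (\row_j f (p^-1%g j))).
    exists p, (\row_j f (p^-1%g j)); split=> // [i|]; first by rewrite mxE.
    rewrite (reindex_inj (@perm_inj _ p)) -[RHS]prodf.
    by apply: eq_bigr => i _; rewrite mxE permK.
  by apply/rowP => i; rewrite Pi_group_mulE mxE permK.
(* At a zero entry the sign is arbitrary and is used to make the product equal to 1; without zero
   entries the common nonzero product cancels. *)
have [/existsP[k /eqP k0]|/existsPn N0] := boolP [exists i, mu 0 (p i) == 0].
  exists (fun i => if i == k then \prod_(j | j != k) e j else e i); split.
  - move=> i; case: eqP => // _.
    by elim/big_rec: _ => [|j x _ [->|->]]; [left| |]; rewrite ?mulr1 ?mulrN1//;
      case: (e1 j) => ->; rewrite ?opprK; auto.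
  - by move=> i; case: eqP => [->|//]; rewrite eE k0 !mul0r.
  - rewrite (bigD1 k)//= eqxx [X in _ * X](eq_bigr (fun j => e j)) => [|j /negPf->//].
    rewrite -big_split/= big1// => j _.
    by case: (e1 j) => ->; rewrite ?mulrNN mulr1.
exists e; split=> //.
have : \prod_i mu 0 (p i) * \prod_i e i = \prod_i mu 0 (p i).
  by rewrite -big_split -[RHS]prodE/=; apply: eq_bigr => i _; rewrite eE.
move/eqP; rewrite -subr_eq0 -{2}[\prod_i mu _ _]mulr1 -mulrBr mulf_eq0.
case/orP; last by rewrite subr_eq0 => /eqP.
by case/prodf_eq0 => i _; rewrite (negPf (N0 i)).
Qed.

(** The pair is (P diag(eps), P^T). As the entries of P are 0 or 1, the entrywise product of P
    diag(eps) with P is P diag(eps) again. *)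
Lemma Pi_group_isopair (R : realType) n (S : 'M[R]_n) : Pi_group S ->
  exists Q1 Q2, [/\ isopair Q1 Q2, S = \matrix_(i, j) (Q1 i j * Q2 j i) &
    forall v, diag_mx (v *m S^T) = Q1 *m diag_mx v *m Q2].
Proof.
case=> s [eps [-> eps1 prod1]].
have ps : perm_mx s *m (perm_mx s)^T = 1%:M :> 'M[R]_n.
  by rewrite tr_perm_mx -perm_mxM mulgV perm_mx1.
exists (perm_mx s *m diag_mx eps), (perm_mx s)^T; split.
  split; last 2 first.
  - by rewrite trmxK tr_perm_mx -perm_mxM mulVg perm_mx1.
  - by rewrite det_mulmx det_diag prod1 mulr1 -det_mulmx ps det1.
  rewrite trmx_mul tr_diag_mx -mulmxA (mulmxA (diag_mx eps)) mulmx_diag.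
  rewrite (_ : diag_mx _ = 1%:M) ?mul1mx//.
  rewrite -diag_const_mx; congr diag_mx; apply/rowP => j; rewrite !mxE.
  by case: (eps1 j) => ->; rewrite ?mulrNN mulr1.
  apply/matrixP => i j; rewrite mul_mx_diag !mxE.
  by case: eqP => _; rewrite ?mul0r ?mulr1.
move=> v; rewrite -(mulmxA _ (diag_mx eps)) mulmx_diag tr_perm_mx.
apply/matrixP => i j; rewrite [LHS]mxE Pi_group_mulE -col_permE -row_permE !mxE.
by rewrite (inj_eq perm_inj) mulrC.
Qed.

(** * Birkhoff's theorem *)

Lemma hall_marriage (I J : finType) (e : I -> J -> bool) :
  (forall A : {set I}, #|A| <= #|[set y | [exists x in A, e x y]]|)%N ->
  exists2 f : I -> J, injective f & forall x, e x (f x).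
Proof.
have [m] := ubnP #|[set p : I * J | e p.1 p.2]|.
elim: m e => // m IH e; rewrite ltnS => em hall.
pose N (r : I -> J -> bool) (A : {set I}) := [set y | [exists x in A, r x y]].
have inN (r : I -> J -> bool) (A : {set I}) y :
    reflect (exists2 x, x \in A & r x y) (y \in N r A).
  by rewrite inE; apply: (iffP exists_inP).
(* If no vertex has two neighbours, Hall's condition on pairs already forces injectivity. *)
have [uniq_e|] := pselect (forall x a b, e x a -> e x b -> a = b).
  have ex x : exists y, e x y.
    have := hall [set x]; rewrite cards1 card_gt0 => /set0Pn[y /inN[z]].
    by rewrite inE => /eqP ->; exists y.
  pose f x := xchoose (ex x); have fe x : e x (f x) := xchooseP (ex x).
  exists f => // x x' fxx'; apply/eqP/contraT => xx'.
  have := hall [set x; x']; rewrite cards2 xx' leqNgt ltnS.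
  suff /subset_leq_card : N e [set x; x'] \subset [set f x] by rewrite cards1 => ->.
  apply/fintype.subsetP => y /inN[z]; rewrite !inE => /orP[]/eqP-> ezy.
    by rewrite (uniq_e _ _ _ ezy (fe x)).
  by rewrite fxx' (uniq_e _ _ _ ezy (fe x')).
move=> /existsNP[x /existsNP[a /existsNP[b]]].
move=> /not_implyP[exa /not_implyP[exb /eqP ab]].
(* Rado's proof: an edge at a vertex x of degree at least 2 can be deleted. *)
pose del c u v := e u v && ((u, v) != (x, c)).
have card_del c : e x c -> (#|[set p : I * J | del c p.1 p.2]| < m)%N.
  move=> exc; apply: leq_trans em; apply/proper_card/properP; split.
    by apply/fintype.subsetP => p; rewrite !inE => /andP[].
  by exists (x, c); rewrite ?inE ?exc//= /del eqxx andbF.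
have tight c : e x c ->
    (forall A : {set I}, #|A| <= #|N (del c) A|)%N \/
    exists2 A : {set I}, x \in A & (#|N (del c) A| < #|A|)%N.
  move=> exc.
  have [|/existsNP[A /negP]] := pselect (forall A : {set I}, #|A| <= #|N (del c) A|)%N.
    by left.
  rewrite -ltnNge => ltA; right; exists A => //; apply: contraLR ltA => xA.
  rewrite -leqNgt; apply: leq_trans (hall A) _.
  apply/subset_leq_card/fintype.subsetP => y.
  move=> /inN[z zA ezy]; apply/inN; exists z => //; rewrite /del ezy xpair_eqE negb_and.
  by case: eqP => // zx; rewrite -zx zA in xA.
have sub c : forall u v, del c u v -> e u v by move=> u v /andP[].
case: (tight a exa) => [hA|[A xA ltA]].
  by have [f fi fe] := IH _ (card_del a exa) hA; exists f => // u; exact: sub (fe u).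
case: (tight b exb) => [hB|[B xB ltB]].
  by have [f fi fe] := IH _ (card_del b exb) hB; exists f => // u; exact: sub (fe u).
(* The vertex x lies in both A and B, and each of the edges to a and b is deleted only on one side,
   so the union loses no neighbour. In [le2] nothing is lost, as x itself is removed. *)
have le1 : (#|A :|: B| <= #|N (del a) A :|: N (del b) B|)%N.
  apply: leq_trans (hall _) _; apply/subset_leq_card/fintype.subsetP => y /inN[z].
  rewrite !finset.in_setU => zAB ezy.
  case: (eqVneq z x) zAB ezy => [->|zx] zAB ezy.
    have [ya|ya] := eqVneq y a.
      apply/orP; right; apply/inN; exists x => //.
      by rewrite /del ezy ya xpair_eqE negb_and ab orbT.
    apply/orP; left; apply/inN; exists x => //.
    by rewrite /del ezy xpair_eqE negb_and ya orbT.
  by case/orP: zAB => zA; apply/orP; [left|right]; apply/inN; exists z;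
    rewrite // /del ezy xpair_eqE negb_and zx.
have le2 : (#|(A :&: B) :\ x| <= #|N (del a) A :&: N (del b) B|)%N.
  apply: leq_trans (hall _) _; apply/subset_leq_card/fintype.subsetP => y /inN[z].
  rewrite !finset.in_setD1 finset.in_setI => /and3P[zx zA zB] ezy.
  by rewrite finset.in_setI; apply/andP; split; apply/inN; exists z;
    rewrite // /del ezy xpair_eqE negb_and zx.
have := cardsD1 x (A :&: B); rewrite finset.in_setI xA xB /=.
have := cardsUI A B; have := cardsUI (N (del a) A) (N (del b) B).
(* Adding up gives |A| + |B| - 1 <= |A| + |B| - 2. *)
move: le1 le2 ltA ltB; lia.
Qed.

(** Membership in a convex hull is expressed as membership in every convex C containing the
    generators; C is later a sublevel set of g. *)
Definition convex_pred (R : numDomainType) (V : lmodType R) (C : V -> Prop) :=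
  forall x y t, 0 <= t <= 1 -> C x -> C y -> C (t *: x + (1 - t) *: y).

Definition doubly_stochastic (R : numDomainType) n (B : 'M[R]_n) :=
  [/\ forall i j, 0 <= B i j, forall i, \sum_j B i j = 1 &
      forall j, \sum_i B i j = 1].

(** Hall's condition for the positive entries: the rows in A have total mass |A|, all of it in the
    neighbouring columns, each of which has mass 1. *)
Lemma doubly_stochastic_diagonal (R : realFieldType) n (B : 'M[R]_n) :
  doubly_stochastic B -> exists s : 'S_n, forall i, 0 < B i (s i).
Proof.
case=> B0 Br Bc.
have [A|f fi fB] := @hall_marriage 'I_n 'I_n (fun i j => 0 < B i j); last first.
  by exists (perm fi) => i; rewrite permE.
rewrite -(ler_nat R) -!sum1_card !natr_sum.
set N := finset _.
rewrite (eq_bigr (fun i => \sum_j B i j)) => [|i _]; last by rewrite Br.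
rewrite [leRHS](eq_bigr (fun j => \sum_i B i j)) => [|j _]; last by rewrite Bc.
rewrite [leRHS]exchange_big/= [leRHS](bigID (mem A))/= ler_wpDr//.
  by apply: sumr_ge0 => i _; apply: sumr_ge0.
apply: ler_sum => i iA; rewrite (bigID (mem N))/= gerDl.
rewrite big1// => j; apply: contraNeq => Bij0; rewrite inE.
by apply/exists_inP; exists i => //; rewrite lt_neqAle eq_sym Bij0 B0.
Qed.

(** Subtracting b times the permutation of a positive diagonal, with b its least entry, creates a
    new zero. The rest, rescaled by 1 / (1 - b), is again doubly stochastic, so induction on the
    number of nonzero entries applies. *)
Lemma birkhoff (R : realFieldType) n (C : 'M[R]_n -> Prop) (B : 'M[R]_n) :
  convex_pred C -> (forall s, C (perm_mx s)) -> doubly_stochastic B -> C B.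
Proof.
move=> Cconv Cperm; have [m] := ubnP #|[set p | B p.1 p.2 != 0]|.
elim: m B => // m IH B; rewrite ltnS => Bm dsB; have [B0 Br Bc] := dsB.
have [s sB] := doubly_stochastic_diagonal dsB.
case: n C B Cconv Cperm IH Bm dsB B0 Br Bc s sB =>
  [|n] C B Cconv Cperm IH Bm dsB B0 Br Bc s sB.
  by rewrite (_ : B = perm_mx s)//; apply/matrixP => -[].
pose i0 : 'I_n.+1 := [arg min_(i < ord0) B i (s i)]%O.
have i0min i : B i0 (s i0) <= B i (s i) by rewrite /i0; case: arg_minP => // j _; exact.
set b := B i0 (s i0) in i0min.
have b0 : 0 < b by exact: sB.
pose D := B - b *: perm_mx s.
have DE i j : D i j = B i j - b *+ (s i == j) by rewrite !mxE mulr_natr.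
have D0 i j : 0 <= D i j.
  by rewrite DE; case: eqP => [<-|_]; rewrite ?mulr1n ?subr_ge0// subr0.
have Dr i : \sum_j D i j = 1 - b.
  under eq_bigr do rewrite DE; rewrite sumrB Br (bigD1 (s i))//= eqxx big1 ?addr0//.
  by move=> j; rewrite eq_sym => /negPf ->.
have Dc j : \sum_i D i j = 1 - b.
  under eq_bigr do rewrite DE.
  rewrite sumrB Bc (bigD1 (s^-1%g j))//= permKV eqxx big1 ?addr0//.
  by move=> i ij; rewrite -(inj_eq (@perm_inj _ s^-1%g)) permK (negPf ij).
have BE : B = b *: perm_mx s + D by rewrite /D addrC subrK.
have b1 : b <= 1 by rewrite -subr_ge0 -(Dr ord0) sumr_ge0.
have [b1'|bN1] := eqVneq b 1.
  have D00 : D = 0.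
    apply/matrixP => i j; rewrite [RHS]mxE; apply/eqP; rewrite eq_le D0 andbT.
    rewrite -(subrr b) [X in X - _]b1' -(Dr i) (bigD1 j)//= lerDl.
    by apply: sumr_ge0 => k _.
  by rewrite BE D00 addr0 b1' scale1r.
have c0 : 0 < 1 - b by rewrite subr_gt0 lt_neqAle bN1.
have -> : B = b *: perm_mx s + (1 - b) *: ((1 - b)^-1 *: D).
  by rewrite scalerA divff ?gt_eqF// scale1r.
apply: Cconv => //; first by rewrite ltW.
apply: IH; last first.
  split=> [i j|i|j].
  - by rewrite mxE mulr_ge0// invr_ge0 ltW.
  - by under eq_bigr do rewrite mxE; rewrite -mulr_sumr Dr mulVf// gt_eqF.
  - by under eq_bigr do rewrite mxE; rewrite -mulr_sumr Dc mulVf// gt_eqF.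
apply: leq_trans Bm; apply/proper_card/properP; split.
  apply/fintype.subsetP => -[i j]; rewrite !inE/= mxE mulf_eq0 negb_or => /andP[_].
  apply: contra => /eqP Bij0; have := D0 i j; rewrite DE Bij0 add0r.
  by case: eqP => [sij|_]; rewrite ?oppr0// mulr1n oppr_ge0 leNgt b0.
exists (i0, s i0); rewrite !inE/=; first by rewrite gt_eqF.
by rewrite mxE DE eqxx mulr1n subrr mulr0 eqxx.
Qed.

(** * The convex hull of the signed permutations *)

Lemma Pi_group_signed_perm (R : realType) n (f : 'I_n -> 'I_n) (e : 'I_n -> R)
    (S : 'M[R]_n) :
  injective f -> (forall j, e j = 1 \/ e j = -1) -> \prod_j e j = 1 ->
  (forall i j, S i j = (f i == j)%:R * e j) -> Pi_group S.
Proof.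
move=> fi e1 prode SE; exists (perm fi), (\row_j e j); split.
- by apply/matrixP => i j; rewrite mul_mx_diag !mxE SE permE.
- by move=> i; rewrite mxE.
- by rewrite -[RHS]prode; apply: eq_bigr => i _; rewrite mxE.
Qed.

Lemma ord2_ind (P : 'I_2 -> Prop) : P 0 -> P 1 -> forall i, P i.
Proof.
move=> P0 P1 [[|[|//]] ilt].
- by rewrite (_ : Ordinal _ = 0)//; exact: val_inj.
- by rewrite (_ : Ordinal _ = 1)//; exact: val_inj.
Qed.

Lemma ord3_ind (P : 'I_3 -> Prop) : P 0 -> P 1 -> P 2 -> forall i, P i.
Proof.
move=> P0 P1 P2 [[|[|[|//]]] ilt].
- by rewrite (_ : Ordinal _ = 0)//; exact: val_inj.
- by rewrite (_ : Ordinal _ = 1)//; exact: val_inj.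
- by rewrite (_ : Ordinal _ = 2)//; exact: val_inj.
Qed.

Lemma big_ord2 (V : nmodType) (F : 'I_2 -> V) : \sum_i F i = F 0 + F 1.
Proof. by rewrite !big_ord_recl big_ord0 addr0; congr (F _ + F _); exact: val_inj. Qed.

Lemma big_ord3 (V : nmodType) (F : 'I_3 -> V) : \sum_i F i = F 0 + F 1 + F 2.
Proof.
rewrite !big_ord_recl big_ord0 addr0 addrA.
by congr (F _ + F _ + F _); exact: val_inj.
Qed.

Lemma prod_ord2 (R : pzRingType) (F : 'I_2 -> R) : \prod_i F i = F 0 * F 1.
Proof. by rewrite !big_ord_recl big_ord0 mulr1; congr (F _ * F _); exact: val_inj. Qed.

Lemma prod_ord3 (R : pzRingType) (F : 'I_3 -> R) : \prod_i F i = F 0 * F 1 * F 2.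
Proof.
rewrite !big_ord_recl big_ord0 mulr1 mulrA.
by congr (F _ * F _ * F _); exact: val_inj.
Qed.

Lemma det_mx22E (R : comPzRingType) (A : 'M[R]_2) :
  \det A = A 0 0 * A 1 1 - A 0 1 * A 1 0.
Proof.
rewrite (expand_det_row _ 0) big_ord2 /cofactor !det_mx11 !mxE /=.
rewrite expr0 mul1r expr1 mulN1r mulrN.
by congr (_ * A _ _ - _ * A _ _); exact: val_inj.
Qed.

(** Indices are added modulo 3; the cyclic order absorbs the cofactor signs. *)
Lemma adj_mx33E (R : comPzRingType) (A : 'M[R]_3) i j :
  \adj A i j =
    A (j + 1) (i + 1) * A (j + 2) (i + 2) - A (j + 1) (i + 2) * A (j + 2) (i + 1).
Proof.
have [sg1 sg2 sg3 sg4] : [/\ (-1) ^+ 1 = -1 :> R, (-1) ^+ 2 = 1 :> R,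
    (-1) ^+ 3 = -1 :> R & (-1) ^+ 4 = 1 :> R] by split; ring.
pose a k l := A (inord k) (inord l).
have aE k l : A k l = a k l by rewrite /a !inord_val.
rewrite mxE /cofactor det_mx22E !mxE !aE.
by elim/ord3_ind: i; elim/ord3_ind: j; rewrite /= /bump /= ?sg1 ?sg2 ?sg3 ?sg4; ring.
Qed.

Lemma orthogonal_adj (R : realFieldType) n (Q : 'M[R]_n) :
  Q *m Q^T = 1%:M -> \adj Q = \det Q *: Q^T.
Proof.
move=> QQ; rewrite -[LHS]mulmx1 -QQ mulmxA mul_adj_mx mul_scalar_mx.
by [].
Qed.

(** With t the trace, (3 - t)(1 + t) is the sum of the squares of the entries of the antisymmetric
    part of Q - Q^T, hence nonnegative, while t <= 3 because the rows are unit vectors. *)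
Lemma rotation3_trace (R : realFieldType) (Q : 'M[R]_3) :
  Q *m Q^T = 1%:M -> \det Q = 1 -> -1 <= \tr Q.
Proof.
move=> QQ detQ; have := orthogonal_adj QQ; rewrite detQ scale1r => adjQ.
have a00 := congr1 (fun M : 'M[R]_3 => M 0 0) adjQ.
have a11 := congr1 (fun M : 'M[R]_3 => M 1 1) adjQ.
have a22 := congr1 (fun M : 'M[R]_3 => M 2 2) adjQ.
have q0 := congr1 (fun M : 'M[R]_3 => M 0 0) QQ.
have q1 := congr1 (fun M : 'M[R]_3 => M 1 1) QQ.
have q2 := congr1 (fun M : 'M[R]_3 => M 2 2) QQ.
have e2 : 2 + 2 = 1 :> 'I_3 by exact: val_inj.
have e1 : 1 + 2 = 0 :> 'I_3 by exact: val_inj.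
have e3 : 2 + 1 = 0 :> 'I_3 by exact: val_inj.
have e4 : 1 + 1 = 2 :> 'I_3 by exact: val_inj.
move: a00 a11 a22 q0 q1 q2; rewrite /= !adj_mx33E ?add0r ?e1 ?e2 ?e3 ?e4.
rewrite !mxE !big_ord3 !mxE /= /mxtrace big_ord3.
move: (Q 0 0) (Q 0 1) (Q 0 2) (Q 1 0) (Q 1 1) (Q 1 2) (Q 2 0) (Q 2 1) (Q 2 2).
move=> a b c d e f g h k a00 a11 a22 q0 q1 q2.
set t := _ + k.
(* adj Q = Q^T expresses the principal minors by the diagonal entries. *)
have key : (3 - t) * (1 + t) = (h - f) ^+ 2 + (c - g) ^+ 2 + (d - b) ^+ 2.
  rewrite /t; move: a00 a11 a22 q0 q1 q2; rewrite ?mulr1n; nra.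
have tle : t <= 3.
  have sq1 (x y z : R) : x * x + y * y + z * z = 1 -> x <= 1 by nra.
  have ha : a <= 1 by apply: (sq1 _ b c); lra.
  have he : e <= 1 by apply: (sq1 _ d f); lra.
  have hk : k <= 1 by apply: (sq1 _ g h); lra.
  rewrite /t; lra.
have : 0 <= (3 - t) * (1 + t) by rewrite key !addr_ge0 ?sqr_ge0.
have [->|tN3] := eqVneq t 3; first by move=> _; lra.
by rewrite pmulr_rge0; lra.
Qed.

(* In the coordinates x = p + q, y = p - q the matrices p I + q J of the hull  *)
(* form the square [-1, 1]^2, whose vertices are I, J, -J and -I.              *)
Lemma hadamard_isopair2_hull (R : realType) (C : 'M[R]_2 -> Prop) (Q1 Q2 : 'M[R]_2) :
  convex_pred C -> (forall S, Pi_group S -> C S) -> isopair Q1 Q2 ->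
  C (\matrix_(i, j) (Q1 i j * Q2 j i)).
Proof.
move=> Cconv CPi [Q1E Q2E detQ].
have rot (Q : 'M[R]_2) : Q *m Q^T = 1%:M ->
    [/\ Q 0 0 ^+ 2 + Q 0 1 ^+ 2 = 1, Q 1 1 = \det Q * Q 0 0 & Q 1 0 = - \det Q * Q 0 1].
  move=> QQ; rewrite det_mx22E.
  have e00 := congr1 (fun M : 'M[R]_2 => M 0 0) QQ.
  have e01 := congr1 (fun M : 'M[R]_2 => M 0 1) QQ.
  move: e00 e01; rewrite !mxE !big_ord2 !mxE /=.
  move: (Q 0 0) (Q 0 1) (Q 1 0) (Q 1 1) => a b c d e00 e01.
  have {}e00 : a * a + b * b = 1 by rewrite e00.
  have {}e01 : a * c + b * d = 0 by rewrite e01.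
  split; first by rewrite !expr2.
  - transitivity ((a * a + b * b) * d - b * (a * c + b * d)); last by ring.
    by rewrite e00 e01; ring.
  - transitivity ((a * a + b * b) * c - a * (a * c + b * d)); last by ring.
    by rewrite e00 e01; ring.
have [a1 d1 c1] := rot _ Q1E; have [a2 d2 c2] := rot _ Q2E.
pose del := \det Q1.
have dd : del * del = 1.
  by case: (orthogonal_det Q1E) => h; rewrite /del h ?mulrNN mulr1.
have det2 : \det Q2 = del by rewrite -[RHS]mulr1 -detQ mulrA dd mul1r.
pose p := Q1 0 0 * Q2 0 0; pose q := - del * Q1 0 1 * Q2 0 1.
pose sgm (f : 'I_2 -> 'I_2) (e : R) : 'M[R]_2 := \matrix_(i, j) ((f i == j)%:R * e).
have sgmP f e : injective f -> e = 1 \/ e = -1 -> C (sgm f e).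
  move=> fi e1; apply: CPi; apply: (@Pi_group_signed_perm R 2 f (fun=> e)) => //.
    by rewrite prod_ord2; case: e1 => ->; rewrite ?mulrNN mulr1.
  by move=> i j; rewrite mxE.
pose sw (i : 'I_2) := i + 1.
(* The weights are those of bilinear interpolation on the square: p is the common diagonal entry and
   q the common off-diagonal one. *)
have -> : \matrix_(i, j) (Q1 i j * Q2 j i) =
    ((1 + (p + q)) / 2) *:
      (((1 + (p - q)) / 2) *: sgm id 1 + (1 - (1 + (p - q)) / 2) *: sgm sw 1)
    + (1 - (1 + (p + q)) / 2) *:
      (((1 + (p - q)) / 2) *: sgm sw (-1) + (1 - (1 + (p - q)) / 2) *: sgm id (-1)).
  have sw1 : sw 1 = 0 by exact: val_inj.
  have sw0 : sw 0 = 1 by exact: val_inj.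
  apply/matrixP => i j; rewrite !mxE.
  elim/ord2_ind: i; elim/ord2_ind: j; rewrite ?sw0 ?sw1 /=.
  - by rewrite /p; field.
  - by rewrite c2 det2 /q; field.
  - by rewrite c1 -/del /q; field.
  - rewrite d1 d2 det2 -/del mulrACA dd mul1r -/p; by field.
(* Cauchy-Schwarz for unit vectors, which gives |p + q| <= 1 and |p - q| <= 1. *)
have bnd (c c' s s' : R) : c ^+ 2 + s ^+ 2 = 1 -> c' ^+ 2 + s' ^+ 2 = 1 ->
    -1 <= c * c' + s * s' <= 1.
  move=> h1 h2.
  have := sqr_ge0 (c - c'); have := sqr_ge0 (c + c').
  have := sqr_ge0 (s - s'); have := sqr_ge0 (s + s').
  by rewrite !sqrrB !sqrrD; lra.
have := bnd _ _ (Q1 0 1) (- del * Q2 0 1) a1; have := bnd _ _ (Q1 0 1) (del * Q2 0 1) a1.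
move=> /(_ (Q2 0 0)) b1 /(_ (Q2 0 0)) b2.
have {b1} b1 : -1 <= p - q <= 1.
  have -> : p - q = Q1 0 0 * Q2 0 0 + Q1 0 1 * (del * Q2 0 1) by rewrite /p /q; ring.
  by apply: b1; rewrite exprMn (expr2 del) dd mul1r.
have {b2} b2 : -1 <= p + q <= 1.
  have -> : p + q = Q1 0 0 * Q2 0 0 + Q1 0 1 * (- del * Q2 0 1) by rewrite /p /q; ring.
  by apply: b2; rewrite exprMn (expr2 (- del)) mulrNN dd mul1r.
have swi : injective sw by move=> i j /addIr.
have mix M N : C M -> C N ->
    C (((1 + (p - q)) / 2) *: M + (1 - (1 + (p - q)) / 2) *: N).
  by apply: Cconv; lra.
by apply: Cconv; [lra|apply: mix|apply: mix]; apply: sgmP => //; auto.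
Qed.

(* The columns of tetra are the vertices (1,1,1), (1,-1,-1), (-1,1,-1) and    *)
(* (-1,-1,1) of a regular tetrahedron; tetra_count is the number of negative  *)
(* terms of an entry of tetra *m P *m tetra^T, for P the permutation t.       *)
Definition tetra_sign (i a : nat) : bool := (a != 0) && (a != i.+1).

Definition tetra (R : comNzRingType) : 'M[R]_(3, 4) :=
  \matrix_(i, a) (-1) ^+ tetra_sign i a.

Definition tetra_count (t : seq nat) (i j : nat) : nat :=
  count (fun a => tetra_sign i a (+) tetra_sign j (nth 0 t a)) (iota 0 4).

(** Each of the 24 vertex permutations is induced by an element of Pi_3. Counts 0, 4 and 2 stand for
    the entries 1, -1 and 0 after division by 4. *)
Lemma tetra_symmetries : all (fun t =>
  has (fun s =>
    has (fun e : seq bool =>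
      all (fun i => all (fun j =>
        tetra_count t i j ==
          if nth 0 s i == j then (if nth false e j then 4 else 0) else 2)
      (iota 0 3)) (iota 0 3))
    [:: [:: false; false; false]; [:: true; true; false];
        [:: true; false; true]; [:: false; true; true]])
  (permutations (iota 0 3)))
  (permutations (iota 0 4)).
Proof. by vm_compute. Qed.

Lemma sum_signs (R : comNzRingType) n (b : nat -> bool) :
  \sum_(a < n) (-1) ^+ b a = n%:R - 2 * (count b (iota 0 n))%:R :> R.
Proof.
elim: n => [|n IH]; first by rewrite big_ord0 mulr0 subr0.
have -> : iota 0 n.+1 = iota 0 n ++ [:: n] by rewrite -addn1 iotaD.
rewrite big_ord_recr /= IH count_cat /= addn0 natrD -[n.+1%:R]natr1.
by case: (b n); rewrite /= ?expr1 ?expr0; ring.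
Qed.

Lemma tetra_perm_mxE (R : comNzRingType) (s : 'S_4) i j :
  (tetra R *m perm_mx s *m (tetra R)^T) i j =
  4 - 2 * (tetra_count [seq nat_of_ord (s a) | a <- enum 'I_4] i j)%:R.
Proof.
rewrite -sum_signs -mulmxA -row_permE mxE; apply: eq_bigr => a _.
rewrite !mxE signr_addb (nth_map a) ?size_enum_ord ?ltn_ord//.
by rewrite nth_ord_enum.
Qed.

Lemma tetra_perm_Pi_group (R : realType) (s : 'S_4) :
  Pi_group (4^-1 *: (tetra R *m perm_mx s *m (tetra R)^T)).
Proof.
set t := [seq nat_of_ord (s a) | a <- enum 'I_4].
have tP : t \in permutations (iota 0 4).
  rewrite mem_permutations uniq_perm ?iota_uniq//.
    by rewrite map_inj_uniq ?enum_uniq// => a b /val_inj/perm_inj.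
  move=> k; rewrite mem_iota add0n /=; apply/mapP/idP => [[a _ ->]//|k4].
  by exists (s^-1%g (Ordinal k4)); rewrite ?mem_enum// permKV.
have /hasP[r rP /hasP[e eP] /allP tre] := allP tetra_symmetries t tP.
have tE (i j : 'I_3) : tetra_count t i j =
    if nth 0 r i == j then (if nth false e j then 4 else 0) else 2.
  have mem3 (k : 'I_3) : (k : nat) \in iota 0 3 by rewrite mem_iota ltn_ord.
  by have /allP/(_ j (mem3 j))/eqP := tre i (mem3 i).
move: rP; rewrite mem_permutations => rP.
have rlt (i : 'I_3) : (nth 0 r i < 3)%N.
  have : nth 0%N r i \in iota 0 3.
    by rewrite -(perm_mem rP) mem_nth// (perm_size rP) size_iota.
  by rewrite mem_iota.
apply: (@Pi_group_signed_perm R 3 (fun i => Ordinal (rlt i))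
  (fun j => (-1) ^+ nth false e j)).
- move=> i j [] /eqP; rewrite nth_uniq ?(perm_size rP) ?size_iota//.
    by move/eqP/val_inj.
  by rewrite (perm_uniq rP) iota_uniq.
- by move=> j; case: nth; [right|left]; rewrite ?expr1 ?expr0.
- rewrite prod_ord3; move: eP; rewrite !inE.
  by case/or4P => /eqP -> /=; rewrite ?expr1 ?expr0; ring.
- move=> i j; rewrite mxE tetra_perm_mxE -/t tE -val_eqE /=.
  by case: eqP => _; case: (nth false e j) => /=; field.
Qed.

Lemma tetra_sum (R : comNzRingType) n : tetra R *m const_mx 1 = 0 :> 'M[R]_(3, n).
Proof.
apply/matrixP => i j; rewrite !mxE.
rewrite (eq_bigr (fun a : 'I_4 => (-1) ^+ tetra_sign i a)) => [|a _]; last first.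
  by rewrite !mxE mulr1.
by rewrite sum_signs; elim/ord3_ind: i; rewrite /= -natrM subrr.
Qed.

Lemma tetra_mul_tr (R : comNzRingType) : tetra R *m (tetra R)^T = 4%:M.
Proof.
have <- : tetra R *m perm_mx 1 *m (tetra R)^T = tetra R *m (tetra R)^T.
  by rewrite perm_mx1 mulmx1.
apply/matrixP => i j; rewrite tetra_perm_mxE mxE.
have -> : [seq nat_of_ord ((1%g : 'S_4) a) | a <- enum 'I_4] = iota 0 4.
  by rewrite -val_enum_ord; apply: eq_map => a; rewrite perm1.
by elim/ord3_ind: i; elim/ord3_ind: j; rewrite /= ?mulr0 ?subr0 -?natrM ?subrr.
Qed.

(** The linear map [Theta] sends permutation matrices into Pi_3, and A = [Theta B], so it suffices
    that B is doubly stochastic. Its row and column sums are 1 because the tetrahedron's vertices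
    sum to zero. *)
Lemma hadamard_isopair3_hull (R : realType) (C : 'M[R]_3 -> Prop) (Q1 Q2 : 'M[R]_3) :
  convex_pred C -> (forall S, Pi_group S -> C S) -> isopair Q1 Q2 ->
  C (\matrix_(i, j) (Q1 i j * Q2 j i)).
Proof.
move=> Cconv CPi [Q1E Q2E detQ]; set A := \matrix_(i, j) _.
pose U := tetra R; pose J : 'M[R]_4 := const_mx 1.
pose Theta (B : 'M[R]_4) := 4^-1 *: (U *m B *m U^T).
pose B : 'M[R]_4 := 4^-1 *: (J + U^T *m A *m U).
have UJ : U *m J = 0 by exact: tetra_sum.
have JU : J *m U^T = 0 by rewrite -[J]trmx_const -trmx_mul UJ trmx0.
have -> : A = Theta B.
  rewrite /Theta /B -scalemxAr -scalemxAl scalerA mulmxDr mulmxDl UJ mul0mx add0r.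
  rewrite !mulmxA tetra_mul_tr -!mulmxA tetra_mul_tr mul_mx_scalar mul_scalar_mx !scalerA.
  by rewrite (_ : _ * _ = 1) ?scale1r//; field.
apply: (@birkhoff R 4 (fun B => C (Theta B))).
- move=> M N t t01 CM CN; rewrite /Theta mulmxDr mulmxDl -!scalemxAr -!scalemxAl.
  rewrite scalerDr !scalerA ![4^-1 * _]mulrC -!scalerA.
  exact: Cconv.
- by move=> s; apply: CPi; exact: tetra_perm_Pi_group.
have BJ n : B *m const_mx 1 = const_mx 1 :> 'M[R]_(4, n).
  rewrite /B -scalemxAl mulmxDl -[_ *m U *m _]mulmxA tetra_sum mulmx0 addr0.
  apply/matrixP => a b; rewrite !mxE.
  rewrite (eq_bigr (fun=> 1)) => [|k _]; last by rewrite !mxE mulr1.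
  by rewrite sumr_const card_ord; field.
have JB n : const_mx 1 *m B = const_mx 1 :> 'M[R]_(n, 4).
  rewrite /B -scalemxAr mulmxDr !mulmxA -[const_mx 1]trmx_const -trmx_mul tetra_sum.
  rewrite trmx0 !mul0mx addr0.
  apply/matrixP => a b; rewrite !mxE.
  rewrite (eq_bigr (fun=> 1)) => [|k _]; last by rewrite !mxE mulr1.
  by rewrite sumr_const card_ord; field.
split.
- move=> a b.
  (* 4 B a b - 1 is the trace of the rotation D a Q1 D b Q2. *)
  pose D (k : 'I_4) := diag_mx (row k U^T).
  have DD k : D k *m (D k)^T = 1%:M.
    rewrite tr_diag_mx mulmx_diag -diag_const_mx; congr diag_mx.
    by apply/rowP => i; rewrite !mxE -signr_addb addbb.
  have detD k : \det (D k) = 1.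
    rewrite det_diag prod_ord3 !mxE -!signr_addb.
    by case: k => [[|[|[|[|//]]]] ?].
  pose W := D a *m Q1 *m D b *m Q2.
  have WW : W *m W^T = 1%:M.
    rewrite /W !trmx_mul -!mulmxA (mulmxA Q2) Q2E mul1mx (mulmxA (D b)) DD mul1mx.
    by rewrite (mulmxA Q1) Q1E mul1mx DD.
  have detW : \det W = 1 by rewrite /W !det_mulmx !detD mul1r mulr1.
  have := rotation3_trace WW detW.
  have -> : \tr W = (U^T *m A *m U) a b.
    rewrite -mulmxA !mxE /mxtrace; apply: eq_bigr => i _.
    rewrite /W -!mulmxA mul_diag_mx !mxE; congr (_ * _).
    apply: eq_bigr => j _.
    by rewrite mul_diag_mx !mxE mulrAC mulrA mulrAC.
  move=> h; rewrite /B 2!mxE [J _ _]mxE mulr_ge0//; lra.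
- move=> i; transitivity ((B *m (const_mx 1 : 'cV[R]_4)) i 0); last by rewrite BJ mxE.
  by rewrite mxE; apply: eq_bigr => j _; rewrite [const_mx _ _ _]mxE mulr1.
- move=> j; transitivity (((const_mx 1 : 'rV[R]_4) *m B) 0 j); last by rewrite JB mxE.
  by rewrite mxE; apply: eq_bigr => i _; rewrite [const_mx _ _ _]mxE mul1r.
Qed.

(** * Convex lower semicontinuous functions *)

Lemma adj_mulmx (R : idomainType) n (A B : 'M[R]_n) :
  \adj (A *m B) = \adj B *m \adj A.
Proof.
(* Invertible matrices first; then perturb A and B by 'X and set 'X to 0. *)
have reg (S : idomainType) (M N : 'M[S]_n) : \det M != 0 -> \det N != 0 ->
    \adj (M *m N) = \adj N *m \adj M.
  move=> M0 N0; apply/subr0_eq; set D := _ - _.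
  have D0 : D *m (M *m N) = 0.
    rewrite mulmxBl mul_adj_mx -mulmxA (mulmxA (\adj M)) mul_adj_mx mul_scalar_mx.
    by rewrite -scalemxAr mul_adj_mx scale_scalar_mx det_mulmx subrr.
  have : D *m (M *m N) *m \adj (M *m N) = 0 by rewrite D0 mul0mx.
  rewrite -mulmxA mul_mx_adj mul_mx_scalar det_mulmx => /matrixP dD.
  apply/matrixP => i j; have /eqP := dD i j; rewrite [RHS]mxE mxE [X in _ == X]mxE.
  by rewrite !mulf_eq0 (negPf M0) (negPf N0) => /eqP.
(* [P M] is M plus the indeterminate times the identity, so its determinant is monic and hence
   nonzero. *)
pose P (M : 'M[R]_n) := char_poly_mx (- M).
have P0 M : \det (P M) != 0 by exact: monic_neq0 (char_poly_monic _).
have PE M : map_mx (horner_eval 0) (P M) = M.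
  apply/matrixP => i j; rewrite !mxE /horner_eval !hornerE.
  by case: eqP => _; rewrite ?mulr1n ?mulr0n !hornerE ?opprK//.
have := congr1 (map_mx (horner_eval 0)) (reg _ _ _ (P0 A) (P0 B)).
by rewrite map_mxM !map_mx_adj map_mxM !PE.
Qed.

Lemma isopair_adj (R : realFieldType) n (Q1 Q2 F : 'M[R]_n) : isopair Q1 Q2 ->
  \adj (Q1 *m F *m Q2) = Q2^T *m \adj F *m Q1^T.
Proof.
case=> Q1E Q2E detQ; rewrite !adj_mulmx (orthogonal_adj Q1E) (orthogonal_adj Q2E).
by rewrite -scalemxAl -!scalemxAr scalerA mulrC detQ scale1r mulmxA.
Qed.

Local Open Scope classical_set_scope.
Local Open Scope ereal_scope.

Lemma linear_rV_continuous (R : realType) m n (f : 'rV[R]_m -> 'rV[R]_n) :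
  linear f -> continuous f.
Proof.
move=> f_lin; pose fL : {linear 'rV[R]_m -> 'rV[R]_n} :=
  HB.pack f (GRing.isLinear.Build _ _ _ _ f f_lin).
have fE x i j : f x i j = (\sum_k x 0%R k * lin1_mx fL k j)%R.
  by rewrite (_ : f x = fL x)// -mul_rV_lin1 mxE ord1.
move=> x A [P Pfx PA].
have near_ij i j : nbhs x [set y | P i j (f y i j)].
  suff fc : continuous (fun y => f y i j) by exact: fc (Pfx i j).
  under eq_fun do rewrite fE.
  apply: continuous_big => [|k _ y]; first exact: add_continuous.
  apply: (@cvgMr_tmp R _ (nbhs y) _ (fun z => z 0%R k) (y 0%R k)).
  exact: coord_continuous.
have : nbhs x [set y | forall i j, P i j (f y i j)].
  apply: (@filter_forall _ _ (fun i y => forall j, P i j (f y i j)) _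
    (nbhs_filter x)) => i.
  apply: (@filter_forall _ _ (fun j y => P i j (f y i j)) _ (nbhs_filter x)) => j.
  exact: near_ij.
by apply: filterS => y Py; apply: PA.
Qed.

Lemma lsc_convex_linear (R : realType) m n (f : 'rV[R]_m -> 'rV[R]_n)
    (g : 'rV[R]_n -> \bar R) :
  linear f -> lsc_convex g -> lsc_convex (g \o f).
Proof.
move=> f_lin [gN gc glsc]; split => /=.
- by move=> x; exact: gN.
- have f0 : f 0%R = 0%R.
    by have := f_lin (-1)%R 0%R 0%R; rewrite scaler0 addr0 scaleN1r addNr.
  have fZ a z : (f (a *: z) = a *: f z)%R.
    by have := f_lin a z 0%R; rewrite f0 !addr0.
  by move=> x y t t01; rewrite /= f_lin fZ; exact: gc.
- move=> x a /glsc[V Vfx Va]; exists (f @^-1` V); last by move=> y /Va.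
  exact: linear_rV_continuous Vfx.
Qed.

Lemma lsc_convex_sup (R : realType) n (I : Type) (D : set I)
    (g : I -> 'rV[R]_n -> \bar R) :
  D !=set0 -> (forall i, D i -> lsc_convex (g i)) ->
  lsc_convex (fun x => ereal_sup [set g i x | i in D]).
Proof.
move=> [i0 Di0] gD; split.
- move=> x; rewrite -ltNye; apply: (@lt_le_trans _ _ (g i0 x)).
    by case: (gD _ Di0) => gN _ _; rewrite ltNye gN.
  by apply: ereal_sup_ubound; exists i0.
- move=> x y t t01; apply: ge_ereal_sup => _ [i Di <-].
  have [_ gc _] := gD i Di; apply: le_trans (gc x y t t01) _.
  case/andP: t01 => t0 t1; apply: leeD; apply: lee_wpmul2l; rewrite ?lee_fin ?subr_ge0//;
    by apply: ereal_sup_ubound; exists i.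
- move=> x a /ereal_sup_gt[_ [i Di <-] agi].
  have [_ _ glsc] := gD i Di; have [V Vx Va] := glsc x a agi.
  exists V => // y Vy; apply: lt_le_trans (Va y Vy) _.
  by apply: ereal_sup_ubound; exists i.
Qed.

(** * The envelopes *)

Lemma ssv_svd (R : realType) n (Q1 Q2 : 'M[R]_n) nu : isopair Q1 Q2 ->
  exists2 S, Pi_group S & ssv (Q1 *m diag_mx nu *m Q2) = nu *m S^T.
Proof.
move=> Q12; have nuP := signed_singular_values_svd nu Q12.
apply: (signed_singular_values_uniq nuP).
exact: (@xgetPex _ 0%R [set mu | signed_singular_values _ mu] (ex_intro _ nu nuP)).
Qed.

Lemma ssv_diag (R : realType) n (nu : 'rV[R]_n) :
  exists2 S, Pi_group S & ssv (diag_mx nu) = nu *m S^T.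
Proof.
by have := ssv_svd nu (isopair1 R n); rewrite mul1mx mulmx1.
Qed.

Lemma sublevel_convex (R : realType) n (E : lmodType R) (T : E -> 'rV[R]_n)
    (g : 'rV[R]_n -> \bar R) (c : \bar R) :
  (forall x y t, T (t *: x + (1 - t) *: y) = t *: T x + (1 - t) *: T y)%R ->
  convex_efun g -> c != -oo%E -> convex_pred (fun x => g (T x) <= c).
Proof.
move=> Taff gc cN x y t t01 gx gy; rewrite Taff; apply: le_trans (gc _ _ t t01) _.
have [t0 t1] := andP t01; case: c cN gx gy => [c| |]// _ gx gy; last by rewrite leey.
have -> : c%:E = t%:E * c%:E + (1 - t)%:E * c%:E.
  by rewrite -!EFinM -EFinD; congr EFin; ring.
by apply: leeD; apply: lee_wpmul2l; rewrite ?lee_fin ?subr_ge0.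
Qed.

Lemma le_lifted_fun (R : realType) d (Phi : 'rV[R]_d -> \bar R) g :
  d = 2%N \/ d = 3%N -> (forall v, g (mlift v) <= Phi v) ->
  forall y, g y <= lifted_fun Phi y.
Proof.
move=> hd gPhi y; have [[v <-]|yN] := pselect (exists v, mlift v = y).
  by rewrite lifted_fun_mlift.
by rewrite lifted_fun_out ?leey// => v yv; apply: yN; exists v.
Qed.

(** Since Psi(w) = G(E(m(w))), the function G o E is a competitor in the convex envelope with the
    same value at m(v). *)
Lemma lsc_svpc_envelope_le (R : realType) d (Phi : 'rV[R]_d -> \bar R)
    (E : 'rV[R]_(2 ^ d - 1) -> 'rV[R]_(minors_dim d)) v :
  d = 2%N \/ d = 3%N -> linear E ->
  (forall w, E (mlift w) = minors (diag_mx w)) ->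
  lsc_svpc_envelope Phi v <= lsc_convex_envelope (lifted_fun Phi) (mlift v).
Proof.
move=> hd linE Em; apply: ge_ereal_sup => _ [Psi [[_ Psi_inv [G [Glsc GE]]] PsiPhi] <-].
have PsiE w : Psi w = (G \o E) (mlift w).
  have [S SP ssvE] := ssv_diag w.
  by rewrite /= Em -GE /= ssvE -Psi_inv.
apply: ereal_sup_ubound; exists (G \o E); last by rewrite PsiE.
split; first exact: lsc_convex_linear.
by apply: le_lifted_fun => // w; rewrite -PsiE.
Qed.

(** [L Q1 Q2] stands for the diagonal part of the minors of Q1 F Q2, read off linearly from those of
    F; [T w A] is its value at diag(w), affine in A. *)
Lemma lsc_svpc_envelope_ge (R : realType) d (Phi : 'rV[R]_d -> \bar R)
    (L : 'M[R]_d -> 'M[R]_d -> 'rV[R]_(minors_dim d) -> 'rV[R]_(2 ^ d - 1))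
    (T : 'rV[R]_d -> 'M[R]_d -> 'rV[R]_(2 ^ d - 1)) v :
  d = 2%N \/ d = 3%N -> Rinfty_valued Phi -> Pi_invariant Phi ->
  (forall (C : 'M[R]_d -> Prop) Q1 Q2, convex_pred C -> (forall S, Pi_group S -> C S) ->
    isopair Q1 Q2 -> C (\matrix_(i, j) (Q1 i j * Q2 j i))%R) ->
  (forall Q1 Q2, linear (L Q1 Q2)) ->
  (forall Q1 Q2 P1 P2 F, isopair P1 P2 ->
    L Q1 Q2 (minors (P1 *m F *m P2)) = L (Q1 *m P1) (P2 *m Q2) (minors F)) ->
  (forall w, L 1%:M%R 1%:M%R (minors (diag_mx w)) = mlift w) ->
  (forall Q1 Q2 w,
    L Q1 Q2 (minors (diag_mx w)) = T w (\matrix_(i, j) (Q1 i j * Q2 j i))%R) ->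
  (forall w A B t, T w (t *: A + (1 - t) *: B) = t *: T w A + (1 - t) *: T w B)%R ->
  lsc_convex_envelope (lifted_fun Phi) (mlift v) <= lsc_svpc_envelope Phi v.
Proof.
move=> hd PhiN Phi_inv hull linL LM L1 LT Taff.
apply: ge_ereal_sup => _ [g [glsc gPhi] <-].
pose G X := ereal_sup [set g (L Q.1 Q.2 X) |
  Q in [set Q : 'M[R]_d * 'M[R]_d | isopair Q.1 Q.2]].
have Glsc : lsc_convex G.
  apply: (lsc_convex_sup (g := fun Q X => g (L Q.1 Q.2 X))).
    by exists (1%:M, 1%:M)%R; exact: isopair1.
  by move=> Q _; exact: (lsc_convex_linear (linL Q.1 Q.2) glsc).
have G_le P1 P2 F : isopair P1 P2 -> G (minors (P1 *m F *m P2)) <= G (minors F).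
  move=> P12; apply: ge_ereal_sup => _ [[Q1 Q2] /= Q12 <-]; apply: ereal_sup_ubound.
  by exists (Q1 *m P1, P2 *m Q2)%R; [exact: isopairM|rewrite /= LM].
have G_inv P1 P2 F : isopair P1 P2 -> G (minors (P1 *m F *m P2)) = G (minors F).
  move=> P12; apply/eqP; rewrite eq_le G_le//=.
  have := G_le _ _ (P1 *m F *m P2)%R (isopair_trmx P12).
  case: P12 => P1E P2E _; rewrite !mulmxA (mulmx1C P1E) mul1mx -mulmxA P2E.
  by rewrite mulmx1.
have G_Pi w S : Pi_group S -> G (minors (diag_mx (w *m S^T))) = G (minors (diag_mx w)).
  by case/Pi_group_isopair => Q1 [Q2 [Q12 _ ->]]; exact: G_inv.
have gPhiL w Q1 Q2 : isopair Q1 Q2 -> g (L Q1 Q2 (minors (diag_mx w))) <= Phi w.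
  move=> Q12; rewrite LT; apply: (hull (fun B => g (T w B) <= Phi w)) => //.
    by apply: sublevel_convex => //; case: glsc.
  (* At S in Pi_d the argument of g is m(S w), so g <= h and the invariance of Phi give the
     bound. *)
  move=> S SP; have [P1 [P2 [P12 SE SP12]]] := Pi_group_isopair SP.
  rewrite [in T w S]SE -LT -[P1]mul1mx -[P2]mulmx1 -LM// -SP12 L1 (Phi_inv w S SP).
  by rewrite -(lifted_fun_mlift Phi (w *m S^T) hd).
pose Psi w := G (minors (diag_mx w)).
apply: le_trans (_ : Psi v <= _).
  apply: ereal_sup_ubound; exists (1%:M, 1%:M)%R; first exact: isopair1.
  by rewrite /= L1.
apply: ereal_sup_ubound; exists Psi => //; split.
  split.
  - by move=> w; case: Glsc => GN _ _; exact: GN.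
  - by move=> w S SP; rewrite /Psi G_Pi.
  - exists G; split=> // F /=; have [Q1 [Q2 [nu [Q12 ->]]]] := isopair_svd_exists F.
    by have [S SP ->] := ssv_svd nu Q12; rewrite /Psi G_Pi// G_inv.
by move=> w; apply: ge_ereal_sup => _ [Q Q12 <-]; exact: gPhiL.
Qed.

Local Open Scope ring_scope.

(** * Explicit coordinates for d = 2 and d = 3 *)

Definition row_seq (R : nmodType) n (s : seq R) : 'rV[R]_n := \row_(j < n) s`_j.

Lemma row_seq_linear (R : pzRingType) n a (s t : seq R) : size s = size t ->
  a *: row_seq n s + row_seq n t = row_seq n [seq a * p.1 + p.2 | p <- zip s t].
Proof.
move=> st; apply/rowP => j; rewrite !mxE.
have [jt|tj] := ltnP j (size t).
  by rewrite (nth_map (0, 0)) ?size_zip ?st ?minnn// nth_zip.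
by rewrite !nth_default ?size_map ?size_zip ?st ?minnn// mulr0 addr0.
Qed.

Lemma mlift2E (R : realType) (v : 'rV[R]_2) :
  mlift v = row_seq 3 [:: v 0 0; v 0 1; v 0 0 * v 0 1].
Proof.
have e0 : @Ordinal 2 0 isT = 0 by exact: val_inj.
have e1 : @Ordinal 2 1 isT = 1 by exact: val_inj.
by rewrite /mlift e0 e1.
Qed.

Lemma mlift3E (R : realType) (v : 'rV[R]_3) :
  mlift v = row_seq 7 [:: v 0 0; v 0 1; v 0 2; v 0 1 * v 0 2; v 0 2 * v 0 0;
    v 0 0 * v 0 1; v 0 0 * v 0 1 * v 0 2].
Proof.
have e0 : @Ordinal 3 0 isT = 0 by exact: val_inj.
have e1 : @Ordinal 3 1 isT = 1 by exact: val_inj.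
have e2 : @Ordinal 3 2 isT = 2 by exact: val_inj.
by rewrite /mlift e0 e1 e2.
Qed.

Definition embed2 (R : realType) (y : 'rV[R]_3) : 'rV[R]_(2 * 2 + 1) :=
  row_mx (mxvec (diag_mx (row_seq 2 [:: y 0 (inord 0); y 0 (inord 1)])))
    (y 0 (inord 2))%:M.

Lemma embed2_linear (R : realType) : linear (@embed2 R).
Proof.
move=> a x y; rewrite /embed2 scale_row_mx add_row_mx -linearP -linearP /=.
by rewrite row_seq_linear//= !mxE scale_scalar_mx -raddfD.
Qed.

Lemma embed2_mlift (R : realType) (w : 'rV[R]_2) :
  embed2 (mlift w) = minors (diag_mx w).
Proof.
rewrite mlift2E /embed2 /= det_diag prod_ord2 !mxE !inordK//=.
by congr (row_mx (mxvec (diag_mx _)) _); apply/rowP; elim/ord2_ind; rewrite !mxE.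
Qed.

Definition embed3 (R : realType) (y : 'rV[R]_7) : 'rV[R]_(3 * 3 + 3 * 3 + 1) :=
  row_mx (row_mx
    (mxvec (diag_mx (row_seq 3 [:: y 0 (inord 0); y 0 (inord 1); y 0 (inord 2)])))
    (mxvec (diag_mx (row_seq 3 [:: y 0 (inord 3); y 0 (inord 4); y 0 (inord 5)]))))
    (y 0 (inord 6))%:M.

Lemma embed3_linear (R : realType) : linear (@embed3 R).
Proof.
move=> a x y; rewrite /embed3 !scale_row_mx !add_row_mx.
rewrite -!(linearP mxvec) -!(linearP (@diag_mx R 3)) /=.
by rewrite !row_seq_linear//= !mxE scale_scalar_mx -raddfD.
Qed.

Lemma adj_diag_mx3 (R : comPzRingType) (w : 'rV[R]_3) :
  \adj (diag_mx w) = diag_mx (row_seq 3 [:: w 0 1 * w 0 2; w 0 2 * w 0 0; w 0 0 * w 0 1]).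
Proof.
by apply/matrixP => i j; rewrite adj_mx33E !mxE; elim/ord3_ind: i; elim/ord3_ind: j;
  rewrite /= ?mulr0n ?mulr1n ?mulr0 ?mul0r ?subr0//;
  congr (w _ _ * w _ _); exact: val_inj.
Qed.

Lemma embed3_mlift (R : realType) (w : 'rV[R]_3) :
  embed3 (mlift w) = minors (diag_mx w).
Proof.
rewrite mlift3E /embed3 /= det_diag adj_diag_mx3 prod_ord3 !mxE !inordK//=.
by congr (row_mx (row_mx (mxvec (diag_mx _)) _) _);
  apply/rowP; elim/ord3_ind; rewrite !mxE.
Qed.

Definition rotated_minors2 (R : comPzRingType) (Q1 Q2 : 'M[R]_2)
    (X : 'rV[R]_(2 * 2 + 1)) : 'rV[R]_3 :=
  let Y := Q1 *m vec_mx (lsubmx X) *m Q2 in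
  row_seq 3 [:: Y 0 0; Y 1 1; rsubmx X 0 0].

Lemma rotated_minors2_linear (R : comPzRingType) (Q1 Q2 : 'M[R]_2) :
  linear (rotated_minors2 Q1 Q2).
Proof.
move=> a x y; rewrite /rotated_minors2 row_seq_linear//= !linearP mulmxDl -scalemxAl.
by rewrite !mxE.
Qed.

(** For a pair in K and X the minors of F, the matrix Z is the adjugate of Y = Q1 F Q2, by
    [isopair_adj]. *)
Definition rotated_minors3 (R : comPzRingType) (Q1 Q2 : 'M[R]_3)
    (X : 'rV[R]_(3 * 3 + 3 * 3 + 1)) : 'rV[R]_7 :=
  let Y := Q1 *m vec_mx (lsubmx (lsubmx X)) *m Q2 in
  let Z := Q2^T *m vec_mx (rsubmx (lsubmx X)) *m Q1^T in
  row_seq 7 [:: Y 0 0; Y 1 1; Y 2 2; Z 0 0; Z 1 1; Z 2 2; rsubmx X 0 0].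

Lemma rotated_minors3_linear (R : comPzRingType) (Q1 Q2 : 'M[R]_3) :
  linear (rotated_minors3 Q1 Q2).
Proof.
move=> a x y; rewrite /rotated_minors3 row_seq_linear//= !linearP !mulmxDl -!scalemxAl.
by rewrite !mxE.
Qed.

Lemma diag_sandwichE (R : comPzRingType) n (Q1 Q2 : 'M[R]_n) (w : 'rV[R]_n) i :
  (Q1 *m diag_mx w *m Q2) i i = (w *m (\matrix_(i, j) (Q1 i j * Q2 j i))^T) 0 i.
Proof.
by rewrite mul_mx_diag !mxE; apply: eq_bigr => j _; rewrite !mxE mulrAC mulrC mulrA.
Qed.

Lemma rotated_minors2M (R : realType) (Q1 Q2 P1 P2 F : 'M[R]_2) : isopair P1 P2 ->
  rotated_minors2 Q1 Q2 (minors (P1 *m F *m P2)) =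
  rotated_minors2 (Q1 *m P1) (P2 *m Q2) (minors F).
Proof.
move=> P12; rewrite /rotated_minors2 /= !row_mxKl !row_mxKr !mxvecK isopair_det//.
by rewrite !mulmxA.
Qed.

Lemma rotated_minors3M (R : realType) (Q1 Q2 P1 P2 F : 'M[R]_3) : isopair P1 P2 ->
  rotated_minors3 Q1 Q2 (minors (P1 *m F *m P2)) =
  rotated_minors3 (Q1 *m P1) (P2 *m Q2) (minors F).
Proof.
move=> P12; rewrite /rotated_minors3 /= !row_mxKl !row_mxKr !mxvecK isopair_det//.
by rewrite isopair_adj// !trmx_mul !mulmxA.
Qed.

Lemma rotated_minors2_mlift (R : realType) (w : 'rV[R]_2) :
  rotated_minors2 1%:M 1%:M (minors (diag_mx w)) = mlift w.
Proof.
rewrite mlift2E /rotated_minors2 /= !row_mxKl !row_mxKr mxvecK mul1mx mulmx1.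
by rewrite det_diag prod_ord2 !mxE.
Qed.

Lemma rotated_minors3_mlift (R : realType) (w : 'rV[R]_3) :
  rotated_minors3 1%:M 1%:M (minors (diag_mx w)) = mlift w.
Proof.
rewrite mlift3E /rotated_minors3 /= !row_mxKl !row_mxKr !mxvecK trmx1 !mul1mx !mulmx1.
by rewrite adj_diag_mx3 det_diag prod_ord3 !mxE.
Qed.

Definition mixed_lift2 (R : comPzRingType) (w : 'rV[R]_2) (A : 'M[R]_2) : 'rV[R]_3 :=
  let y := w *m A^T in row_seq 3 [:: y 0 0; y 0 1; \det (diag_mx w)].

Definition mixed_lift3 (R : comPzRingType) (w : 'rV[R]_3) (A : 'M[R]_3) : 'rV[R]_7 :=
  let y := w *m A^T in
  let z := row_seq 3 [:: w 0 1 * w 0 2; w 0 2 * w 0 0; w 0 0 * w 0 1] *m A^T in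
  row_seq 7 [:: y 0 0; y 0 1; y 0 2; z 0 0; z 0 1; z 0 2; \det (diag_mx w)].

Lemma rotated_minors2_diag (R : realType) (Q1 Q2 : 'M[R]_2) (w : 'rV[R]_2) :
  rotated_minors2 Q1 Q2 (minors (diag_mx w)) =
  mixed_lift2 w (\matrix_(i, j) (Q1 i j * Q2 j i)).
Proof.
rewrite /rotated_minors2 /= !row_mxKl !row_mxKr mxvecK !diag_sandwichE.
by rewrite [_%:M 0 0]mxE.
Qed.

Lemma rotated_minors3_diag (R : realType) (Q1 Q2 : 'M[R]_3) (w : 'rV[R]_3) :
  rotated_minors3 Q1 Q2 (minors (diag_mx w)) =
  mixed_lift3 w (\matrix_(i, j) (Q1 i j * Q2 j i)).
Proof.
rewrite /rotated_minors3 /= !row_mxKl !row_mxKr !mxvecK adj_diag_mx3 !diag_sandwichE.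
rewrite [_%:M 0 0]mxE /mixed_lift3.
(* The pair (Q2^T, Q1^T) acting on the adjugate yields the same A, so one convex combination serves
   both blocks. *)
suff -> : \matrix_(i, j) (Q2^T i j * Q1^T j i) = \matrix_(i, j) (Q1 i j * Q2 j i) by [].
by apply/matrixP => i j; rewrite !mxE mulrC.
Qed.

Lemma mixed_lift2_affine (R : comPzRingType) (w : 'rV[R]_2) (A B : 'M[R]_2) t :
  mixed_lift2 w (t *: A + (1 - t) *: B) =
  t *: mixed_lift2 w A + (1 - t) *: mixed_lift2 w B.
Proof.
rewrite /mixed_lift2 /= linearP linearZ /= mulmxDr -!scalemxAr.
apply/rowP => -[[|[|[|//]]] jlt]; rewrite !mxE //=.
by rewrite -mulrDl addrC subrK mul1r.
Qed.

Lemma mixed_lift3_affine (R : comPzRingType) (w : 'rV[R]_3) (A B : 'M[R]_3) t :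
  mixed_lift3 w (t *: A + (1 - t) *: B) =
  t *: mixed_lift3 w A + (1 - t) *: mixed_lift3 w B.
Proof.
rewrite /mixed_lift3 /= linearP linearZ /= !mulmxDr -!scalemxAr.
apply/rowP => -[[|[|[|[|[|[|[|//]]]]]]] jlt]; rewrite !mxE //=.
(* The determinant coordinate does not depend on A; it is preserved because the weights sum to 1. *)
by rewrite -mulrDl addrC subrK mul1r.
Qed.

Theorem proposition3 (R : realType) (d : nat) (hd : d = 2%N \/ d = 3%N)
    (Phi : 'rV[R]_d -> \bar R) (Phi_Rinfty : Rinfty_valued Phi)
    (Phi_inv : Pi_invariant Phi) :
  lsc_svpc_envelope Phi = (lsc_convex_envelope (lifted_fun Phi) \o @mlift R d)%FUN.
Proof.
apply/funext => v; apply/eqP; rewrite eq_le; apply/andP; split.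
- case: hd Phi Phi_Rinfty Phi_inv v => -> Phi _ _ v.
  + apply: (@lsc_svpc_envelope_le R 2 Phi (@embed2 R)); first by left.
      exact: embed2_linear.
    exact: embed2_mlift.
  + apply: (@lsc_svpc_envelope_le R 3 Phi (@embed3 R)); first by right.
      exact: embed3_linear.
    exact: embed3_mlift.
- case: hd Phi Phi_Rinfty Phi_inv v => -> Phi PhiN Phi_inv v /=.
  + apply: (@lsc_svpc_envelope_ge R 2 Phi (@rotated_minors2 R) (@mixed_lift2 R)) => //.
    * by left.
    * exact: hadamard_isopair2_hull.
    * exact: rotated_minors2_linear.
    * exact: rotated_minors2M.
    * exact: rotated_minors2_mlift.
    * exact: rotated_minors2_diag.
    * exact: mixed_lift2_affine.
  + apply: (@lsc_svpc_envelope_ge R 3 Phi (@rotated_minors3 R) (@mixed_lift3 R)) => //.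
    * by right.
    * exact: hadamard_isopair3_hull.
    * exact: rotated_minors3_linear.
    * exact: rotated_minors3M.
    * exact: rotated_minors3_mlift.
    * exact: rotated_minors3_diag.
    * exact: mixed_lift3_affine.
Qed.
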